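(* Let $n>1$ and let $\mathcal R=(r^{1-n}/\rho)D_r$. The radial compressible Euler equations in $n$ dimensions possess: (a) for a general equation of state $p=p(\rho,S)$, a hierarchy of scalar invariants $$J_l=\mathcal R^{\,l}S$$ of order $l=0,1,2,\ldots$; (b) for an entropic equation of state $p=\kappa(S)$ (with $\kappa$ non-constant), two additional hierarchies of scalar invariants, consisting of the first-order invariants $$J_{1,1}=U^2+\tfrac2n\, r p_r/\rho,\qquad J_{2,1}=A(r,U,p_r/\rho)-t,$$ and, for $l=2,3,\ldots$, the invariants of order $l$ $$J_{1,l}=\mathcal R^{\,l-1}\big(U^2+\tfrac2n\, r p_r/\rho\big),\qquad J_{2,l}=\mathcal R^{\,l-1}\big(A(r,U,p_r/\rho)-t\big),$$ where $$A(r,U,p_r/\rho)=\int_0^r\frac{dy}{\sqrt{U^2+\tfrac2n\big(1-(y/r)^n\big)\,r p_r/\rho}}=\int_0^1\frac{r\,dy}{\sqrt{U^2+\tfrac2n(1-y^n)\,r p_r/\rho}} .$$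
   Context: Radial Euler equations: for functions $U(r,t)$ (radial velocity), $\rho(r,t)$ (density), $S(r,t)$ (entropy), with $r>0$ the radial coordinate in $\mathbb{R}^n$, $n>1$, $$U_t+UU_r+(p_S S_r+p_\rho\rho_r)/\rho=0,\quad \rho_t+(U\rho)_r+\tfrac{n-1}{r}U\rho=0,\quad S_t+US_r=0,$$ with equation of state $p=p(\rho,S)$. ''General equation of state'' means $p$ is an arbitrary function of $\rho,S$. In the entropic case $p_r=\kappa'(S)S_r$. $D_t$, $D_r$ denote total derivatives, acting by the chain rule on the fluid variables and their derivatives, and $|_{\mathcal E}$ means evaluation on the solution space, i.e. all $t$-derivatives are eliminated by means of the Euler equations. A scalar invariant is a function $J$ of $t,r$, the fluid variables $U,\rho,S$ and finitely many of their $r$-derivatives such that $(D_tJ+U D_rJ)|_{\mathcal E}=0$. Its order is the highest order of $r$-derivative appearing in it.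
   Formalization: J_{2,l} as written is proved for U>0 and J_{1,1}>0; for U<0 the formula fails (if p_r=0, A−t has material derivative −2), so −A−t replaces A−t there; U=0, where A is not differentiable, is excluded, also in the equality of the two integrals. p and κ are taken smooth. *)

(* Defs.v *)
From Stdlib Require Import Reals.
From Coquelicot Require Import Coquelicot.
Open Scope R_scope.

(** Jet space in [t], [r], the fluid variables and their [r]-derivatives:
    [Var f k] is the coordinate of the [k]-th [r]-derivative of [f]. *)

Inductive fluid : Set := Vel | Dens | Entr.

Inductive coord : Set := Time | Rad | Var (f : fluid) (k : nat).

Lemma coord_eq_dec (c d : coord) : {c = d} + {c <> d}.
Proof. decide equality; [apply PeanoNat.Nat.eq_dec | decide equality]. Defined.

Definition jet := coord -> R.

Definition upd (j : jet) (c : coord) (x : R) : jet :=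
  fun d => if coord_eq_dec d c then x else j d.

Definition xt (j : jet) : R := j Time.
Definition xr (j : jet) : R := j Rad.
Definition vU (j : jet) : R := j (Var Vel 0).
Definition vrho (j : jet) : R := j (Var Dens 0).
Definition vS (j : jet) : R := j (Var Entr 0).
Definition vU_r (j : jet) : R := j (Var Vel 1).
Definition vrho_r (j : jet) : R := j (Var Dens 1).
Definition vS_r (j : jet) : R := j (Var Entr 1).

Definition partial (c : coord) (F : jet -> R) (j : jet) : R :=
  Derive (fun x => F (upd j c x)) (j c).

(** Continuity is for the sup-metric on [coord -> R]; for a function of
    finitely many coordinates this is joint continuity in those coordinates. *)
Fixpoint Ck (k : nat) (D : jet -> Prop) (F : jet -> R) : Prop :=
  (forall j, D j ->
     @continuous (fct_UniformSpace coord R_UniformSpace) R_UniformSpace F j) /\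
  match k with
  | O => True
  | S k' => forall c,
      (forall j, D j -> ex_derive (fun x => F (upd j c x)) (j c)) /\
      Ck k' D (partial c F)
  end.

Definition smooth_on (D : jet -> Prop) (F : jet -> R) : Prop :=
  forall k, Ck k D F.

(** The series below have finitely many nonzero terms when [F] depends on
    finitely many coordinates. *)

Definition D_r (F : jet -> R) (j : jet) : R :=
  let sum f := Series (fun k => j (Var f (S k)) * partial (Var f k) F j) in
  partial Rad F j + (sum Vel + sum Dens + sum Entr).

(** [v f k] stands for the mixed derivative [d_t d_r^k f]. *)
Definition D_t (F : jet -> R) (v : fluid -> nat -> R) (j : jet) : R :=
  let sum f := Series (fun k => v f k * partial (Var f k) F j) in
  partial Time F j + (sum Vel + sum Dens + sum Entr).

(** The radial Euler equations, solved for the [t]-derivatives. *)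
Definition euler_rhs (n : nat) (p : R -> R -> R) (f : fluid) (j : jet) : R :=
  let p_rho := Derive (fun x => p x (vS j)) (vrho j) in
  let p_S := Derive (fun x => p (vrho j) x) (vS j) in
  match f with
  | Vel => - (vU j * vU_r j) - (p_S * vS_r j + p_rho * vrho_r j) / vrho j
  | Dens => - (vU_r j * vrho j + vU j * vrho_r j)
            - (INR n - 1) / xr j * (vU j * vrho j)
  | Entr => - (vU j * vS_r j)
  end.

(** [D_t F] evaluated on the solution space: every [d_t d_r^k f] is replaced
    using the Euler equations and their [r]-derivatives. *)
Definition D_t_on_E (n : nat) (p : R -> R -> R) (F : jet -> R) (j : jet) : R :=
  D_t F (fun f k => Nat.iter k D_r (euler_rhs n p f) j) j.

Definition coord_order (c : coord) : nat :=
  match c with Var _ k => k | _ => O end.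

(** On [D], the highest order of an [r]-derivative on which [F] depends is [m]. *)
Definition has_order (D : jet -> Prop) (F : jet -> R) (m : nat) : Prop :=
  (forall j j', D j -> D j' ->
     (forall c, (coord_order c <= m)%nat -> j c = j' c) -> F j = F j') /\
  (exists (f : fluid) (j : jet) (x : R),
     D j /\ D (upd j (Var f m) x) /\ F (upd j (Var f m) x) <> F j).

Definition scalar_invariant (n : nat) (p : R -> R -> R)
    (D : jet -> Prop) (F : jet -> R) (m : nat) : Prop :=
  smooth_on D F /\ has_order D F m /\
  (forall j, D j -> D_t_on_E n p F j + vU j * D_r F j = 0).

Definition flow_domain (Om : R * R -> Prop) (j : jet) : Prop :=
  0 < xr j /\ 0 < vrho j /\ Om (vrho j, vS j).

(** The equation of state as a function on jet space; its smoothness on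
    [flow_domain Om] is that of [p] on the part of [Om] with positive density. *)
Definition pressure (p : R -> R -> R) (j : jet) : R := p (vrho j) (vS j).

Definition Rop (n : nat) (F : jet -> R) (j : jet) : R :=
  / xr j ^ (n - 1) / vrho j * D_r F j.

Definition J (n l : nat) : jet -> R := Nat.iter l (Rop n) vS.

(** The entropic case [p = kappa(S)], with [kappa] given on the interval [(a, b)]. *)

Definition entropic (kappa : R -> R) (rho s : R) : R := kappa s.

Definition entropy_range (a b : Rbar) (z : R * R) : Prop :=
  Rbar_lt a (snd z) /\ Rbar_lt (snd z) b.

Definition p_r_over_rho (kappa : R -> R) (j : jet) : R :=
  Derive kappa (vS j) * vS_r j / vrho j.

Definition energy (n : nat) (r U q : R) : R := U ^ 2 + 2 / INR n * (r * q).

Definition J11 (n : nat) (kappa : R -> R) (j : jet) : R :=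
  energy n (xr j) (vU j) (p_r_over_rho kappa j).

Definition A (n : nat) (r U q : R) : R :=
  RInt (fun y => / sqrt (U ^ 2 + 2 / INR n * (1 - (y / r) ^ n) * (r * q))) 0 r.

Definition J21 (n : nat) (kappa : R -> R) (j : jet) : R :=
  A n (xr j) (vU j) (p_r_over_rho kappa j) - xt j.

Definition J1 (n : nat) (kappa : R -> R) (l : nat) : jet -> R :=
  Nat.iter (l - 1) (Rop n) (J11 n kappa).

Definition J2 (n : nat) (kappa : R -> R) (l : nat) : jet -> R :=
  Nat.iter (l - 1) (Rop n) (J21 n kappa).

(** The radicand in [A] runs monotonically from [J11] at [y = 0] to [U^2] at
    [y = r], so away from [U = 0], where [A] is not differentiable, the integral
    exists exactly when [J11 > 0].  Along the flow [A] has derivative [U / sqrt (U^2)],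
    whence the positive root is the right one for [U > 0]. *)
Definition outflow_domain (n : nat) (kappa : R -> R) (Om : R * R -> Prop)
    (j : jet) : Prop :=
  flow_domain Om j /\ 0 < vU j /\ 0 < J11 n kappa j.

(** For [U < 0] the root in [A] has to be the negative one. *)
Definition J2_inflow (n : nat) (kappa : R -> R) (l : nat) : jet -> R :=
  Nat.iter (l - 1) (Rop n)
    (fun j => - A n (xr j) (vU j) (p_r_over_rho kappa j) - xt j).

Definition inflow_domain (n : nat) (kappa : R -> R) (Om : R * R -> Prop)
    (j : jet) : Prop :=
  flow_domain Om j /\ vU j < 0 /\ 0 < J11 n kappa j.

(* Main.v *)
(** On the solution space [D_t] commutes with [D_r], and conservation of mass gives
    [(D_t + U D_r) w = w U_r] for [w = r^(1-n) / rho].  Hence [R = w D_r] commutes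
    with the material derivative [D_t + U D_r] and maps invariants to invariants.
    The derivative of [R F] in its highest coordinate is [w] times that of [F],
    so [R] raises the order by exactly one.

    It remains to treat the seeds [S], [J11] and [J21].  In the entropic case
    [q = p_r / rho] satisfies [Dq = (n-1) U q / r] along the flow, besides
    [Dr = U] and [DU = -q].  By scaling, [A = (r / |U|) phi(z)] with
    [z = 2 r q / (n U^2)] and [phi(z)] the integral of [(1 + (1 - y^n) z)^(-1/2)]
    over [0 <= y <= 1]; since [Dz = (n U / r) z (1 + z)], the invariance of [J21]
    is the equation [(1 + n z / 2) phi + n z (1 + z) phi' = 1]. *)

From Stdlib Require Import Reals Lra Lia FunctionalExtensionality Classical.
From Coquelicot Require Import Coquelicot.
(* Required last: Coquelicot's [AutoDerive.Var] would shadow [Defs.Var]. *)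
Require Import Defs.
Open Scope R_scope.

(** * Smooth functions on jet space *)

(** Two obstacles shape the proof. Jet space has infinitely many coordinates and total derivatives
    are series, so smoothness is always carried together with a bound on the order ([nice]); the
    series then become finite sums ([csum]), on which the usual calculus of vector fields can be
    carried out. Moreover most identities hold only on a domain [D] where divisors and radicands are
    positive, and it is the openness of [D] that lets an equality on [D] pass to derivatives.

    That [D_t] and [D_r] commute is a Lie bracket computation: the second derivatives cancel by
    Schwarz, and the coefficients agree because the time derivative of an [r]-derivative is by
    construction an iterated [D_r].

    Exact order is tracked by one nonvanishing partial derivative, in an entropy coordinate, at a
    single jet. For [J11] and [J21] it is a multiple of [kappa'], which the mean value theorem makes
    nonzero at some entropy; for [J21] it also contains [phi'(z)], which is negative. The scaled
    form of [A] has fixed limits and a single parameter, so one differentiation under the integral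
    sign yields all its smoothness. *)

Notation jets := (fct_UniformSpace coord R_UniformSpace).

Definition jopen (D : jet -> Prop) : Prop := @open jets D.

Definition jcont (F : jet -> R) (j : jet) : Prop :=
  @continuous jets R_UniformSpace F j.

Lemma upd_eq (j : jet) (c : coord) (x : R) : upd j c x c = x.
Proof. unfold upd; destruct (coord_eq_dec c c); congruence. Qed.

Lemma upd_neq (j : jet) (c d : coord) (x : R) : d <> c -> upd j c x d = j d.
Proof. intros H; unfold upd; destruct (coord_eq_dec d c); congruence. Qed.

Lemma upd_same (j : jet) (c : coord) : upd j c (j c) = j.
Proof.
  apply functional_extensionality; intros d; unfold upd.
  destruct (coord_eq_dec d c); congruence.
Qed.

Lemma upd_upd (j : jet) (c : coord) (x y : R) : upd (upd j c x) c y = upd j c y.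
Proof.
  apply functional_extensionality; intros d; unfold upd.
  destruct (coord_eq_dec d c); congruence.
Qed.

Lemma upd_comm (j : jet) (c d : coord) (x y : R) :
  c <> d -> upd (upd j c x) d y = upd (upd j d y) c x.
Proof.
  intros H; apply functional_extensionality; intros e; unfold upd.
  destruct (coord_eq_dec e c), (coord_eq_dec e d); congruence.
Qed.

Lemma jball_intro (j j' : jet) (e : posreal) :
  (forall c, Rabs (j' c - j c) < e) -> @ball jets j e j'.
Proof. intros H c; apply H. Qed.

Lemma jopen_upd2 (D : jet -> Prop) (j : jet) (c d : coord) :
  jopen D -> D j -> c <> d ->
  locally_2d (fun u v => D (upd (upd j c u) d v)) (j c) (j d).
Proof.
  intros HD Hj Hcd; destruct (HD j Hj) as [e He].
  exists e; intros u v Hu Hv; apply He, jball_intro; intros a; unfold upd.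
  destruct (coord_eq_dec a d) as [->|]; [exact Hv|].
  destruct (coord_eq_dec a c) as [->|]; [exact Hu|].
  rewrite Rminus_diag, Rabs_R0; apply cond_pos.
Qed.

Lemma jopen_upd (D : jet -> Prop) (j : jet) (c : coord) :
  jopen D -> D j -> locally (j c) (fun x => D (upd j c x)).
Proof.
  intros HD Hj; destruct (HD j Hj) as [e He].
  exists e; intros u Hu; apply He, jball_intro; intros a; unfold upd.
  destruct (coord_eq_dec a c) as [->|]; [exact Hu|].
  rewrite Rminus_diag, Rabs_R0; apply cond_pos.
Qed.

Lemma partial_ext (D : jet -> Prop) (F G : jet -> R) (c : coord) (j : jet) :
  jopen D -> (forall j, D j -> F j = G j) -> D j -> partial c F j = partial c G j.
Proof.
  intros HD HFG Hj; apply Derive_ext_loc.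
  generalize (jopen_upd D j c HD Hj); apply filter_imp; intros x Hx; now apply HFG.
Qed.

(** Near a point of the open set [D] the two functions agree, so they have the same limits and
    derivatives there. The rules for products, inverses and compositions rely on this, their
    formulas for [partial] being valid only on [D]. *)
Lemma Ck_ext (D : jet -> Prop) (k : nat) : jopen D ->
  forall F G, (forall j, D j -> F j = G j) -> Ck k D F -> Ck k D G.
Proof.
  intros HD; induction k as [|k IH]; intros F G HFG [HF1 HF2]; split;
    try exact I;
    try (intros j Hj; apply (continuous_ext_loc (T := jets) _ F);
         [generalize (HD j Hj); apply filter_imp; exact HFG | now apply HF1]).
  intros c; destruct (HF2 c) as [H1 H2]; split.
  - intros j Hj; apply (ex_derive_ext_loc (fun x => F (upd j c x))); [|now apply H1].
    generalize (jopen_upd D j c HD Hj); apply filter_imp; intros x Hx; now apply HFG.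
  - apply (IH (partial c F)); [|exact H2].
    intros j Hj; now apply (partial_ext D).
Qed.

Lemma Ck_S (D : jet -> Prop) (k : nat) : forall F, Ck (S k) D F -> Ck k D F.
Proof.
  induction k as [|k IH]; intros F [H1 H2].
  - now split.
  - split; [exact H1|]; intros c; destruct (H2 c) as [H3 H4].
    split; [exact H3 | exact (IH _ H4)].
Qed.

Lemma Ck_cont (D : jet -> Prop) (k : nat) (F : jet -> R) (j : jet) :
  Ck k D F -> D j -> jcont F j.
Proof. destruct k; intros [H _]; apply H. Qed.

Lemma Ck_const (D : jet -> Prop) (k : nat) : forall a : R, Ck k D (fun _ => a).
Proof.
  induction k as [|k IH]; intros a; split; try exact I;
    try (intros; apply continuous_const).
  intros c; split; [intros; apply ex_derive_const|].
  replace (partial c (fun _ => a)) with (fun _ : jet => 0); [apply IH|].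
  apply functional_extensionality; intros j; unfold partial; now rewrite Derive_const.
Qed.

Lemma partial_coord (c d : coord) (j : jet) :
  partial c (fun i => i d) j = if coord_eq_dec d c then 1 else 0.
Proof.
  unfold partial, upd; destruct (coord_eq_dec d c).
  - apply Derive_id.
  - apply Derive_const.
Qed.

Lemma Ck_coord (D : jet -> Prop) (k : nat) (d : coord) : Ck k D (fun j => j d).
Proof.
  destruct k as [|k]; split; try exact I;
    try (intros j _ P [e He]; exists e; intros j' Hj'; apply He, Hj').
  intros c; split.
  - intros j Hj; unfold upd; destruct (coord_eq_dec d c);
      [apply ex_derive_id | apply ex_derive_const].
  - replace (partial c (fun j => j d))
      with (fun _ : jet => if coord_eq_dec d c then 1 else 0); [apply Ck_const|].
    apply functional_extensionality; intros j; now rewrite partial_coord.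
Qed.

Lemma partial_plus (F G : jet -> R) (c : coord) (j : jet) :
  ex_derive (fun x => F (upd j c x)) (j c) ->
  ex_derive (fun x => G (upd j c x)) (j c) ->
  partial c (fun i => F i + G i) j = partial c F j + partial c G j.
Proof. intros; unfold partial; now apply Derive_plus. Qed.

Lemma partial_mult (F G : jet -> R) (c : coord) (j : jet) :
  ex_derive (fun x => F (upd j c x)) (j c) ->
  ex_derive (fun x => G (upd j c x)) (j c) ->
  partial c (fun i => F i * G i) j = partial c F j * G j + F j * partial c G j.
Proof.
  intros HF HG; unfold partial; rewrite Derive_mult; [|assumption..].
  now rewrite !upd_same.
Qed.

Lemma partial_inv (F : jet -> R) (c : coord) (j : jet) :
  ex_derive (fun x => F (upd j c x)) (j c) -> F j <> 0 ->
  partial c (fun i => / F i) j = - partial c F j * (/ F j * / F j).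
Proof.
  intros HF H0; unfold partial; rewrite Derive_inv; [| assumption | now rewrite upd_same].
  rewrite !upd_same; now field.
Qed.

Lemma is_derive_partial_comp (g : R -> R) (l : R) (F : jet -> R) (c : coord) (j : jet) :
  is_derive g (F j) l -> ex_derive (fun x => F (upd j c x)) (j c) ->
  is_derive (fun x => g (F (upd j c x))) (j c) (l * partial c F j).
Proof.
  intros Hg HF; rewrite Rmult_comm.
  apply (is_derive_comp g (fun x => F (upd j c x))).
  - now rewrite upd_same.
  - now apply Derive_correct.
Qed.

Lemma partial_comp (g : R -> R) (l : R) (F : jet -> R) (c : coord) (j : jet) :
  is_derive g (F j) l -> ex_derive (fun x => F (upd j c x)) (j c) ->
  partial c (fun i => g (F i)) j = l * partial c F j.
Proof. intros; now apply is_derive_unique, is_derive_partial_comp. Qed.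

Lemma Ck_plus (D : jet -> Prop) (k : nat) : jopen D ->
  forall F G, Ck k D F -> Ck k D G -> Ck k D (fun j => F j + G j).
Proof.
  intros HD; induction k as [|k IH]; intros F G [F1 F2] [G1 G2]; split; try exact I;
    try (intros j Hj; apply (continuous_plus (U := jets) F G); auto).
  intros c; destruct (F2 c) as [F3 F4], (G2 c) as [G3 G4]; split.
  - intros j Hj; apply (ex_derive_plus (fun x => F (upd j c x)) (fun x => G (upd j c x))); auto.
  - eapply (Ck_ext D k HD); [|apply (IH _ _ F4 G4)].
    intros j Hj; symmetry; apply partial_plus; auto.
Qed.

Lemma Ck_mult (D : jet -> Prop) (k : nat) : jopen D ->
  forall F G, Ck k D F -> Ck k D G -> Ck k D (fun j => F j * G j).
Proof.
  intros HD; induction k as [|k IH]; intros F G HF HG;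
    pose proof HF as [F1 F2]; pose proof HG as [G1 G2]; split; try exact I;
    try (intros j Hj; apply (continuous_mult (U := jets) (K := R_AbsRing) F G); auto).
  apply Ck_S in HF; apply Ck_S in HG.
  intros c; destruct (F2 c) as [F3 F4], (G2 c) as [G3 G4]; split.
  - intros j Hj; apply (ex_derive_mult (fun x => F (upd j c x)) (fun x => G (upd j c x))); auto.
  - apply (Ck_ext D k HD (fun j => partial c F j * G j + F j * partial c G j)).
    + intros j Hj; symmetry; apply partial_mult; auto.
    + apply Ck_plus; auto.
Qed.

Lemma Ck_inv (D : jet -> Prop) (k : nat) : jopen D ->
  forall F, (forall j, D j -> F j <> 0) -> Ck k D F -> Ck k D (fun j => / F j).
Proof.
  intros HD; induction k as [|k IH]; intros F H0 HF; pose proof HF as [F1 F2];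
    split; try exact I;
    try (intros j Hj; apply (continuous_comp (U := jets) F Rinv);
         [auto | apply continuous_Rinv; auto]).
  apply Ck_S in HF.
  intros c; destruct (F2 c) as [F3 F4]; split.
  - intros j Hj; apply (ex_derive_inv (fun x => F (upd j c x))); auto.
    rewrite upd_same; auto.
  - apply (Ck_ext D k HD (fun j => (-1 * partial c F j) * (/ F j * / F j))).
    + intros j Hj; rewrite partial_inv by auto; ring.
    + apply Ck_mult; auto.
      * apply Ck_mult; auto using Ck_const.
      * apply Ck_mult; auto.
Qed.

(** Smoothness of a one-variable function is given by the sequence of its
    successive derivatives. *)
Lemma Ck_comp (D : jet -> Prop) (P : R -> Prop) (g : nat -> R -> R) (F : jet -> R)
    (k : nat) : jopen D ->
  (forall i x, P x -> is_derive (g i) x (g (S i) x)) ->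
  (forall j, D j -> P (F j)) -> Ck k D F ->
  forall i, Ck k D (fun j => g i (F j)).
Proof.
  intros HD Hg HP; induction k as [|k IH]; intros HF i; pose proof HF as [F1 F2];
    split; try exact I;
    try (intros j Hj; apply (continuous_comp (U := jets) F (g i));
         [auto | apply (ex_derive_continuous (V := R_NormedModule)); exists (g (S i) (F j)); auto]).
  apply Ck_S in HF.
  intros c; destruct (F2 c) as [F3 F4]; split.
  - intros j Hj; exists (g (S i) (F j) * partial c F j); apply is_derive_partial_comp; auto.
  - apply (Ck_ext D k HD (fun j => g (S i) (F j) * partial c F j)).
    + intros j Hj; symmetry; apply partial_comp; auto.
    + apply Ck_mult; auto.
Qed.

(** * Smooth functions of finite order *)

Definition order_le (D : jet -> Prop) (m : nat) (F : jet -> R) : Prop :=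
  forall j j', D j -> D j' -> (forall c, (coord_order c <= m)%nat -> j c = j' c) ->
  F j = F j'.

Definition nice (D : jet -> Prop) (m : nat) (F : jet -> R) : Prop :=
  smooth_on D F /\ order_le D m F.

Lemma nice_cont (D : jet -> Prop) (m : nat) (F : jet -> R) (j : jet) :
  nice D m F -> D j -> jcont F j.
Proof. intros [H _]; apply (Ck_cont D 0), H. Qed.

Lemma nice_ex_derive (D : jet -> Prop) (m : nat) (F : jet -> R) (c : coord) (j : jet) :
  nice D m F -> D j -> ex_derive (fun x => F (upd j c x)) (j c).
Proof. intros [H _]; destruct (H 1%nat) as [_ H1]; apply (H1 c). Qed.

Lemma nice_le (D : jet -> Prop) (m m' : nat) (F : jet -> R) :
  (m <= m')%nat -> nice D m F -> nice D m' F.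
Proof.
  intros Hm [H1 H2]; split; [exact H1|].
  intros j j' Hj Hj' H; apply H2; auto; intros c Hc; apply H; lia.
Qed.

Lemma nice_ext (D : jet -> Prop) (m : nat) (F G : jet -> R) :
  jopen D -> (forall j, D j -> F j = G j) -> nice D m F -> nice D m G.
Proof.
  intros HD HFG [H1 H2]; split.
  - intros k; apply (Ck_ext D k HD F); auto.
  - intros j j' Hj Hj' H; rewrite <- !HFG; auto.
Qed.

Lemma nice_const (D : jet -> Prop) (m : nat) (a : R) : nice D m (fun _ => a).
Proof. split; [intros k; apply Ck_const | now intros j j']. Qed.

Lemma nice_coord (D : jet -> Prop) (m : nat) (c : coord) :
  (coord_order c <= m)%nat -> nice D m (fun j => j c).
Proof. intros Hc; split; [intros k; apply Ck_coord | intros j j' _ _ H; auto]. Qed.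

Lemma nice_plus (D : jet -> Prop) (m : nat) (F G : jet -> R) :
  jopen D -> nice D m F -> nice D m G -> nice D m (fun j => F j + G j).
Proof.
  intros HD [F1 F2] [G1 G2]; split.
  - intros k; now apply Ck_plus.
  - intros j j' Hj Hj' H; rewrite (F2 j j'), (G2 j j'); auto.
Qed.

Lemma nice_mult (D : jet -> Prop) (m : nat) (F G : jet -> R) :
  jopen D -> nice D m F -> nice D m G -> nice D m (fun j => F j * G j).
Proof.
  intros HD [F1 F2] [G1 G2]; split.
  - intros k; now apply Ck_mult.
  - intros j j' Hj Hj' H; rewrite (F2 j j'), (G2 j j'); auto.
Qed.

Lemma nice_inv (D : jet -> Prop) (m : nat) (F : jet -> R) :
  jopen D -> (forall j, D j -> F j <> 0) -> nice D m F -> nice D m (fun j => / F j).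
Proof.
  intros HD H0 [F1 F2]; split.
  - intros k; now apply Ck_inv.
  - intros j j' Hj Hj' H; rewrite (F2 j j'); auto.
Qed.

Lemma nice_comp (D : jet -> Prop) (P : R -> Prop) (g : nat -> R -> R) (F : jet -> R)
    (m i : nat) : jopen D ->
  (forall i x, P x -> is_derive (g i) x (g (S i) x)) ->
  (forall j, D j -> P (F j)) -> nice D m F -> nice D m (fun j => g i (F j)).
Proof.
  intros HD Hg HP [F1 F2]; split.
  - intros k; now apply (Ck_comp D P).
  - intros j j' Hj Hj' H; rewrite (F2 j j'); auto.
Qed.

Lemma partial_order_gt (D : jet -> Prop) (m : nat) (F : jet -> R) (c : coord) (j : jet) :
  jopen D -> order_le D m F -> (m < coord_order c)%nat -> D j -> partial c F j = 0.
Proof.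
  intros HD HF Hc Hj; unfold partial.
  rewrite <- (Derive_const (F j) (j c)); apply Derive_ext_loc.
  generalize (jopen_upd D j c HD Hj); apply filter_imp; intros x Hx.
  apply HF; auto; intros d Hd; apply upd_neq; intros ->; lia.
Qed.

Lemma nice_partial (D : jet -> Prop) (m : nat) (F : jet -> R) (c : coord) :
  jopen D -> nice D m F -> nice D m (partial c F).
Proof.
  intros HD [H1 H2]; split.
  - intros k; destruct (H1 (S k)) as [_ H3]; apply (H3 c).
  - intros j j' Hj Hj' H.
    (* The base points [j c] and [j' c] are known to agree only for [c] of order at most [m]; beyond
       that order both derivatives vanish. *)
    destruct (Nat.le_gt_cases (coord_order c) m) as [Hc|Hc].
    2: now rewrite !(partial_order_gt D m).
    unfold partial; rewrite <- (H c Hc); apply Derive_ext_loc.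
    generalize (jopen_upd D j' c HD Hj') (jopen_upd D j c HD Hj).
    rewrite (H c Hc); intros L L'; generalize (filter_and _ _ L L').
    apply filter_imp; intros x [Hx Hx']; apply H2; auto.
    intros d Hd; unfold upd; destruct (coord_eq_dec d c); auto.
Qed.

Lemma jcont_upd2 (F : jet -> R) (j : jet) (c d : coord) :
  jcont F j -> continuity_2d_pt (fun u v => F (upd (upd j c u) d v)) (j c) (j d).
Proof.
  intros HF eps.
  assert (L : locally (F j) (fun y => Rabs (y - F j) < eps)) by (now exists eps).
  destruct (HF _ L) as [e He]; exists e; intros u v Hu Hv.
  rewrite upd_same, upd_same; apply He, jball_intro; intros a; unfold upd.
  destruct (coord_eq_dec a d) as [->|]; [exact Hv|].
  destruct (coord_eq_dec a c) as [->|]; [exact Hu|].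
  rewrite Rminus_diag, Rabs_R0; apply cond_pos.
Qed.

(** Schwarz's theorem on the two-dimensional slice of jet space through [j] in the directions [c]
    and [d]. Sup-metric continuity of the second derivatives supplies the joint continuity that it
    asks for. *)
Lemma partial_comm (D : jet -> Prop) (m : nat) (F : jet -> R) (c d : coord) (j : jet) :
  jopen D -> nice D m F -> D j ->
  partial c (partial d F) j = partial d (partial c F) j.
Proof.
  intros HD HF Hj.
  destruct (coord_eq_dec c d) as [->|Hcd]; [reflexivity|].
  set (f := fun u v => F (upd (upd j c u) d v)).
  assert (Ed : forall u v, Derive (fun t => f u t) v = partial d F (upd (upd j c u) d v)).
  { intros u v; unfold partial, f; rewrite upd_eq; apply Derive_ext; intros t.
    now rewrite upd_upd. }
  assert (Ec : forall u v, Derive (fun t => f t v) u = partial c F (upd (upd j c u) d v)).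
  { intros u v; unfold partial, f; rewrite upd_neq, upd_eq by auto.
    apply Derive_ext; intros t.
    now rewrite (upd_comm _ c d u v), upd_upd, upd_comm by auto. }
  assert (Edc : forall u v, Derive (fun z => Derive (fun t => f z t) v) u
      = partial c (partial d F) (upd (upd j c u) d v)).
  { intros u v; unfold partial at 1; rewrite upd_neq, upd_eq by auto.
    apply Derive_ext; intros t; rewrite Ed.
    now rewrite (upd_comm _ c d u v), upd_upd, upd_comm by auto. }
  assert (Ecd : forall u v, Derive (fun z => Derive (fun t => f t z) u) v
      = partial d (partial c F) (upd (upd j c u) d v)).
  { intros u v; unfold partial at 1; rewrite upd_eq.
    apply Derive_ext; intros t; rewrite Ec; now rewrite upd_upd. }
  assert (E0 : upd (upd j c (j c)) d (j d) = j) by now rewrite !upd_same.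
  assert (Hc := nice_partial D m F c HD HF).
  assert (Hd := nice_partial D m F d HD HF).
  assert (S := Schwarz f (j c) (j d)).
  rewrite Edc, Ecd, E0 in S; apply S; clear S.
  - apply locally_2d_impl with (2 := jopen_upd2 D j c d HD Hj Hcd).
    apply locally_2d_forall; intros u v Huv.
    set (i := upd (upd j c u) d v) in *.
    assert (iu : i c = u) by (unfold i; now rewrite upd_neq, upd_eq).
    assert (iv : i d = v) by (unfold i; now rewrite upd_eq).
    assert (ic : forall t, upd i c t = upd (upd j c t) d v).
    { intros t; unfold i.
      now rewrite (upd_comm _ c d u v), upd_upd, upd_comm by auto. }
    assert (id : forall t, upd i d t = upd (upd j c u) d t).
    { intros t; unfold i; now rewrite upd_upd. }
    repeat split.
    + generalize (nice_ex_derive D m F c i HF Huv); rewrite iu; apply ex_derive_ext.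
      intros t; now rewrite ic.
    + generalize (nice_ex_derive D m F d i HF Huv); rewrite iv; apply ex_derive_ext.
      intros t; now rewrite id.
    + generalize (nice_ex_derive D m _ c i Hd Huv); rewrite iu; apply ex_derive_ext.
      intros t; now rewrite ic, Ed.
    + generalize (nice_ex_derive D m _ d i Hc Huv); rewrite iv; apply ex_derive_ext.
      intros t; now rewrite id, Ec.
  - apply continuity_2d_pt_ext with (1 := fun u v => eq_sym (Edc u v)).
    apply jcont_upd2, (nice_cont D m); auto using nice_partial.
  - apply continuity_2d_pt_ext with (1 := fun u v => eq_sym (Ecd u v)).
    apply jcont_upd2, (nice_cont D m); auto using nice_partial.
Qed.

(** * Total derivatives and the operator [R] *)

Definition level (g : coord -> R) (k : nat) : R :=
  g (Var Vel k) + g (Var Dens k) + g (Var Entr k).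

(** Finite stand-in for a sum over all coordinates: applied to a function of order at most [N], it
    contains every nonzero term of the series in the total derivatives. *)
Fixpoint csum (N : nat) (g : coord -> R) : R :=
  match N with
  | O => g Time + g Rad + level g O
  | S N' => csum N' g + level g (S N')
  end.

Lemma csum_ext (N : nat) (g h : coord -> R) :
  (forall c, (coord_order c <= N)%nat -> g c = h c) -> csum N g = csum N h.
Proof.
  intros H; induction N as [|N IH]; simpl; unfold level.
  - rewrite !H; simpl; auto.
  - rewrite IH, !H; simpl; auto.
Qed.

Lemma csum_plus (N : nat) (g h : coord -> R) :
  csum N (fun c => g c + h c) = csum N g + csum N h.
Proof. induction N as [|N IH]; simpl; rewrite ?IH; unfold level; ring. Qed.

Lemma csum_scal (N : nat) (a : R) (g : coord -> R) :
  csum N (fun c => a * g c) = a * csum N g.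
Proof. induction N as [|N IH]; simpl; rewrite ?IH; unfold level; ring. Qed.

Lemma csum_zero (N : nat) (g : coord -> R) :
  (forall c, (coord_order c <= N)%nat -> g c = 0) -> csum N g = 0.
Proof.
  intros H; rewrite (csum_ext N g (fun _ => 0 * 0)).
  - rewrite csum_scal; ring.
  - intros c Hc; rewrite H; auto; ring.
Qed.

Lemma csum_single (N : nat) (d : coord) (g : coord -> R) :
  (coord_order d <= N)%nat -> (forall c, c <> d -> g c = 0) -> csum N g = g d.
Proof.
  intros Hd H.
  assert (K : forall c, g c = if coord_eq_dec c d then g d else 0).
  { intros c; destruct (coord_eq_dec c d) as [->|]; auto. }
  induction N as [|N IH].
  - simpl; unfold level; rewrite (K Time), (K Rad), !(K (Var _ _)).
    destruct d as [| |f [|k]]; simpl in Hd; [| | |lia]; try destruct f;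
      repeat destruct (coord_eq_dec _ _); try congruence; ring.
  - simpl; destruct (Nat.eq_dec (coord_order d) (S N)) as [E|E].
    + rewrite csum_zero.
      * destruct d as [| |f k]; simpl in E; try lia; subst k.
        unfold level; rewrite (K (Var Vel _)), (K (Var Dens _)), (K (Var Entr _)).
        destruct f; repeat destruct (coord_eq_dec _ _); try congruence; ring.
      * intros c Hc; apply H; intros ->; lia.
    + rewrite IH by lia; unfold level.
      rewrite !(H (Var _ (S N))) by (intros <-; simpl in *; lia); ring.
Qed.

Lemma csum_swap (N M : nat) (g : coord -> coord -> R) :
  csum N (fun c => csum M (g c)) = csum M (fun d => csum N (fun c => g c d)).
Proof.
  induction N as [|N IH]; simpl; unfold level; rewrite ?IH, <- !csum_plus; reflexivity.
Qed.

Lemma csum_split (N : nat) (g : coord -> R) :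
  csum N g = g Time + g Rad +
    (sum_f_R0 (fun k => g (Var Vel k)) N + sum_f_R0 (fun k => g (Var Dens k)) N +
     sum_f_R0 (fun k => g (Var Entr k)) N).
Proof. induction N as [|N IH]; simpl; rewrite ?IH; unfold level; ring. Qed.

Lemma Series_finite (a : nat -> R) (N : nat) :
  (forall k, (N < k)%nat -> a k = 0) -> Series a = sum_f_R0 a N.
Proof.
  intros H; apply is_series_unique.
  change (is_lim_seq (sum_n a) (sum_f_R0 a N)).
  apply (is_lim_seq_ext_loc (fun _ => sum_f_R0 a N) (sum_n a)); [|apply is_lim_seq_const].
  exists N; intros k Hk; rewrite sum_n_Reals; induction Hk as [|k Hk IH]; [reflexivity|].
  simpl; rewrite <- IH, H; [ring | lia].
Qed.

(** A derivation with coefficients frozen at one jet. A genuine vector field is a family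
    [Y : jet -> coord -> R], applied as [vf (Y i) F i]; [D_r], [D_t_on_E], the material derivative
    and the partial derivatives are all of this kind, so one set of calculus rules serves them
    all. *)
Definition vf (X : coord -> R) (F : jet -> R) (j : jet) : R :=
  let sum f := Series (fun k => X (Var f k) * partial (Var f k) F j) in
  X Time * partial Time F j + X Rad * partial Rad F j + (sum Vel + sum Dens + sum Entr).

Lemma vf_csum (D : jet -> Prop) (m : nat) (X : coord -> R) (F : jet -> R) (j : jet) :
  jopen D -> nice D m F -> D j -> vf X F j = csum m (fun c => X c * partial c F j).
Proof.
  intros HD [_ HF] Hj; unfold vf; rewrite csum_split.
  rewrite !(Series_finite _ m); [reflexivity|..];
    intros k Hk; rewrite (partial_order_gt D m); auto; ring.
Qed.

Lemma vf_ext (D : jet -> Prop) (X : coord -> R) (F G : jet -> R) (j : jet) :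
  jopen D -> (forall i, D i -> F i = G i) -> D j -> vf X F j = vf X G j.
Proof.
  intros HD H Hj; unfold vf; rewrite !(fun c => partial_ext D F G c j HD H Hj).
  rewrite (Series_ext _ (fun k => X (Var Vel k) * partial (Var Vel k) G j)).
  rewrite (Series_ext (fun k => X (Var Dens k) * _)
    (fun k => X (Var Dens k) * partial (Var Dens k) G j)).
  rewrite (Series_ext (fun k => X (Var Entr k) * _)
    (fun k => X (Var Entr k) * partial (Var Entr k) G j)).
  reflexivity.
  all: intros k; now rewrite (partial_ext D F G).
Qed.

Lemma vf_lin (D : jet -> Prop) (m : nat) (X Y : coord -> R) (a : R) (F : jet -> R) (j : jet) :
  jopen D -> nice D m F -> D j ->
  vf (fun c => X c + a * Y c) F j = vf X F j + a * vf Y F j.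
Proof.
  intros HD HF Hj; rewrite !(vf_csum D m) by auto.
  rewrite <- csum_scal, <- csum_plus; apply csum_ext; intros; ring.
Qed.

Lemma vf_const (X : coord -> R) (a : R) (j : jet) : vf X (fun _ => a) j = 0.
Proof.
  rewrite (vf_csum (fun _ => True) 0).
  - apply csum_zero; intros c _; unfold partial; rewrite Derive_const; ring.
  - intros i _; apply filter_true.
  - apply nice_const.
  - exact I.
Qed.

Lemma vf_coord (X : coord -> R) (d : coord) (j : jet) : vf X (fun i => i d) j = X d.
Proof.
  rewrite (vf_csum (fun _ => True) (coord_order d)).
  - rewrite (csum_single _ d); [|lia|].
    + rewrite partial_coord; destruct (coord_eq_dec d d); [ring | congruence].
    + intros c Hc; rewrite partial_coord; destruct (coord_eq_dec d c); [congruence | ring].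
  - intros i _; apply filter_true.
  - now apply nice_coord.
  - exact I.
Qed.

Lemma vf_plus (D : jet -> Prop) (m : nat) (X : coord -> R) (F G : jet -> R) (j : jet) :
  jopen D -> nice D m F -> nice D m G -> D j ->
  vf X (fun i => F i + G i) j = vf X F j + vf X G j.
Proof.
  intros HD HF HG Hj; rewrite !(vf_csum D m) by auto using nice_plus.
  rewrite <- csum_plus; apply csum_ext; intros c _.
  rewrite partial_plus by (eapply nice_ex_derive; eauto); ring.
Qed.

Lemma vf_mult (D : jet -> Prop) (m : nat) (X : coord -> R) (F G : jet -> R) (j : jet) :
  jopen D -> nice D m F -> nice D m G -> D j ->
  vf X (fun i => F i * G i) j = vf X F j * G j + F j * vf X G j.
Proof.
  intros HD HF HG Hj; rewrite !(vf_csum D m) by auto using nice_mult.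
  rewrite (Rmult_comm _ (G j)), <- !csum_scal, <- csum_plus; apply csum_ext; intros c _.
  rewrite partial_mult by (eapply nice_ex_derive; eauto); ring.
Qed.

Lemma vf_inv (D : jet -> Prop) (m : nat) (X : coord -> R) (F : jet -> R) (j : jet) :
  jopen D -> (forall i, D i -> F i <> 0) -> nice D m F -> D j ->
  vf X (fun i => / F i) j = - vf X F j * (/ F j * / F j).
Proof.
  intros HD H0 HF Hj; rewrite !(vf_csum D m) by auto using nice_inv.
  replace (- _ * _) with
    ((-1 * (/ F j * / F j)) * csum m (fun c => X c * partial c F j)) by ring.
  rewrite <- csum_scal; apply csum_ext; intros c _.
  rewrite partial_inv by (auto; eapply nice_ex_derive; eauto); ring.
Qed.

Lemma vf_comp (D : jet -> Prop) (P : R -> Prop) (g : nat -> R -> R) (m : nat)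
    (X : coord -> R) (F : jet -> R) (i : nat) (j : jet) :
  jopen D -> (forall i x, P x -> is_derive (g i) x (g (S i) x)) ->
  (forall j, D j -> P (F j)) -> nice D m F -> D j ->
  vf X (fun i' => g i (F i')) j = g (S i) (F j) * vf X F j.
Proof.
  intros HD Hg HP HF Hj; rewrite !(vf_csum D m) by (auto; now apply (nice_comp D P)).
  rewrite <- csum_scal; apply csum_ext; intros c _.
  rewrite (partial_comp _ (g (S i) (F j))) by (auto; eapply nice_ex_derive; eauto); ring.
Qed.

(** Lets the product and chain rules proved for [vf] compute partial derivatives as well. *)
Lemma vf_unit (D : jet -> Prop) (m : nat) (F : jet -> R) (d : coord) (j : jet) :
  jopen D -> nice D m F -> D j ->
  vf (fun c => if coord_eq_dec c d then 1 else 0) F j = partial d F j.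
Proof.
  intros HD HF Hj.
  (* The sum has to reach [d] even if [d] lies above the order of [F]. *)
  rewrite (vf_csum D (max m (coord_order d))); auto.
  2: apply nice_le with m; auto; lia.
  rewrite (csum_single _ d); [|lia|].
  - destruct (coord_eq_dec d d); [ring | congruence].
  - intros c Hc; destruct (coord_eq_dec c d); [congruence | ring].
Qed.

Lemma nice_csum (D : jet -> Prop) (m N : nat) (a : coord -> jet -> R) :
  jopen D -> (forall c, (coord_order c <= N)%nat -> nice D m (a c)) ->
  nice D m (fun j => csum N (fun c => a c j)).
Proof.
  intros HD H; induction N as [|N IH]; simpl; unfold level;
    repeat apply (nice_plus D m); auto; apply H; simpl; lia.
Qed.

Lemma vf_sum (D : jet -> Prop) (m N : nat) (X : coord -> R) (a : coord -> jet -> R) (j : jet) :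
  jopen D -> (forall c, (coord_order c <= N)%nat -> nice D m (a c)) -> D j ->
  vf X (fun i => csum N (fun c => a c i)) j = csum N (fun c => vf X (a c) j).
Proof.
  intros HD H Hj; induction N as [|N IH]; simpl; unfold level.
  - assert (K : forall c, (coord_order c <= 0)%nat -> nice D m (fun i => a c i)) by auto.
    rewrite !(vf_plus D m); auto; repeat apply (nice_plus D m); auto; apply K; simpl; lia.
  - assert (K : forall c, (coord_order c <= S N)%nat -> nice D m (fun i => a c i)) by auto.
    assert (K' := nice_csum D m N a HD (fun c Hc => H c (Nat.le_le_succ_r _ _ Hc))).
    rewrite !(vf_plus D m); auto; [rewrite IH; auto|..];
      repeat apply (nice_plus D m); auto; apply K; simpl; lia.
Qed.

Lemma nice_vf (D : jet -> Prop) (m M : nat) (Y : jet -> coord -> R) (F : jet -> R) :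
  jopen D -> (m <= M)%nat -> nice D m F ->
  (forall c, (coord_order c <= m)%nat -> nice D M (fun i => Y i c)) ->
  nice D M (fun i => vf (Y i) F i).
Proof.
  intros HD Hm HF HY.
  apply (nice_ext D M (fun i => csum m (fun c => Y i c * partial c F i))); auto.
  - intros i Hi; symmetry; now apply (vf_csum D m).
  - apply (nice_csum D M m (fun c i => Y i c * partial c F i)); auto.
    intros c Hc; apply nice_mult; auto.
    apply nice_le with m; auto using nice_partial.
Qed.

Lemma vf_vf (D : jet -> Prop) (m M : nat) (X : coord -> R) (Y : jet -> coord -> R)
    (F : jet -> R) (j : jet) :
  jopen D -> (m <= M)%nat -> nice D m F ->
  (forall c, (coord_order c <= m)%nat -> nice D M (fun i => Y i c)) -> D j ->
  vf X (fun i => vf (Y i) F i) j =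
  csum m (fun c => vf X (fun i => Y i c) j * partial c F j) +
  csum m (fun c => csum m (fun d => Y j c * X d * partial d (partial c F) j)).
Proof.
  intros HD Hm HF HY Hj.
  assert (HP : forall c, nice D M (partial c F)).
  { intros c; apply nice_le with m; auto using nice_partial. }
  rewrite (vf_ext D X _ (fun i => csum m (fun c => Y i c * partial c F i))); auto.
  2: intros i Hi; now apply (vf_csum D m).
  rewrite (vf_sum D M m X (fun c i => Y i c * partial c F i)); auto using nice_mult.
  rewrite <- csum_plus; apply csum_ext; intros c Hc.
  rewrite (vf_mult D M); auto; f_equal.
  rewrite (vf_csum D m X (partial c F)); auto using nice_partial.
  rewrite <- csum_scal; apply csum_ext; intros; ring.
Qed.

(** Two vector fields commute on [F] once they commute on the coordinates: the terms with second
    derivatives of [F] form a double sum symmetric in [X] and [Y], and what remains is the bracket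
    of the coefficients. *)
Lemma vf_bracket (D : jet -> Prop) (m M : nat) (X Y : jet -> coord -> R)
    (F : jet -> R) (j : jet) :
  jopen D -> (m <= M)%nat -> nice D m F ->
  (forall c, (coord_order c <= m)%nat -> nice D M (fun i => X i c)) ->
  (forall c, (coord_order c <= m)%nat -> nice D M (fun i => Y i c)) -> D j ->
  (forall c, (coord_order c <= m)%nat ->
     vf (X j) (fun i => Y i c) j = vf (Y j) (fun i => X i c) j) ->
  vf (X j) (fun i => vf (Y i) F i) j = vf (Y j) (fun i => vf (X i) F i) j.
Proof.
  intros HD Hm HF HX HY Hj H; rewrite !(vf_vf D m M) by auto; f_equal.
  - apply csum_ext; intros c Hc; now rewrite H.
  - rewrite csum_swap; apply csum_ext; intros c _; apply csum_ext; intros d _.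
    rewrite (partial_comm D m); auto; ring.
Qed.

(** * Total derivatives and the material derivative as vector fields *)

Definition rcoef (j : jet) (c : coord) : R :=
  match c with Time => 0 | Rad => 1 | Var f k => j (Var f (S k)) end.

Definition tcoef (n : nat) (p : R -> R -> R) (j : jet) (c : coord) : R :=
  match c with
  | Time => 1
  | Rad => 0
  | Var f k => Nat.iter k D_r (euler_rhs n p f) j
  end.

Lemma D_r_vf (F : jet -> R) (j : jet) : D_r F j = vf (rcoef j) F j.
Proof. unfold D_r, vf; simpl; ring. Qed.

Lemma D_t_vf (n : nat) (p : R -> R -> R) (F : jet -> R) (j : jet) :
  D_t_on_E n p F j = vf (tcoef n p j) F j.
Proof. unfold D_t_on_E, D_t, vf; simpl; ring. Qed.

Lemma nice_rcoef (D : jet -> Prop) (m : nat) (c : coord) :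
  (coord_order c <= m)%nat -> nice D (S m) (fun i => rcoef i c).
Proof.
  destruct c as [| |f k]; simpl; intros H; try apply nice_const.
  apply nice_coord; simpl; lia.
Qed.

Lemma nice_D_r (D : jet -> Prop) (m : nat) (F : jet -> R) :
  jopen D -> nice D m F -> nice D (S m) (D_r F).
Proof.
  intros HD HF; apply (nice_ext D _ (fun i => vf (rcoef i) F i)); auto.
  - intros i _; symmetry; apply D_r_vf.
  - apply (nice_vf D m); auto; apply nice_rcoef.
Qed.

(** All that the passage from a seed to its hierarchy uses about the equation of state and the
    domain; it covers the general and the entropic case at once. *)
Definition admissible (n : nat) (p : R -> R -> R) (D : jet -> Prop) : Prop :=
  jopen D /\ (forall j, D j -> 0 < xr j /\ 0 < vrho j) /\
  (forall f, nice D 1 (euler_rhs n p f)).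

Lemma nice_tcoef (n : nat) (p : R -> R -> R) (D : jet -> Prop) (m : nat) (c : coord) :
  admissible n p D -> (coord_order c <= m)%nat -> nice D (S m) (fun i => tcoef n p i c).
Proof.
  intros (HD & _ & HE); destruct c as [| |f k]; simpl; intros H; try apply nice_const.
  apply nice_le with (S k); [lia|]; clear m H.
  change (nice D (S k) (Nat.iter k D_r (euler_rhs n p f))).
  induction k as [|k IH]; [apply HE|].
  change (nice D (S (S k)) (D_r (Nat.iter k D_r (euler_rhs n p f)))); now apply nice_D_r.
Qed.

(** It suffices to compare coefficients. Those of [Time] and [Rad] are constant, and on [Var f k]
    both orders of application give [D_r] iterated [S k] times on [euler_rhs n p f]. *)
Lemma D_t_D_r_comm (n : nat) (p : R -> R -> R) (D : jet -> Prop) (m : nat)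
    (F : jet -> R) (j : jet) :
  admissible n p D -> nice D m F -> D j ->
  D_t_on_E n p (D_r F) j = D_r (D_t_on_E n p F) j.
Proof.
  intros HA HF Hj; pose proof HA as (HD & _).
  rewrite D_t_vf, D_r_vf.
  rewrite (vf_ext D _ (D_r F) (fun i => vf (rcoef i) F i));
    auto using D_r_vf.
  rewrite (vf_ext D _ (D_t_on_E n p F) (fun i => vf (tcoef n p i) F i));
    auto using D_t_vf.
  apply (vf_bracket D m (S m)); auto using nice_rcoef, nice_tcoef.
  intros [| |f k] _; simpl.
  - now rewrite !vf_const.
  - now rewrite !vf_const.
  - rewrite vf_coord; symmetry; exact (eq_sym (D_r_vf _ j)).
Qed.

(** Components of the material derivative [D_t + U D_r] on the solution space. *)
Definition mcoef (n : nat) (p : R -> R -> R) (j : jet) (c : coord) : R :=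
  tcoef n p j c + vU j * rcoef j c.

Lemma material_vf (n : nat) (p : R -> R -> R) (D : jet -> Prop) (m : nat)
    (F : jet -> R) (j : jet) :
  jopen D -> nice D m F -> D j ->
  D_t_on_E n p F j + vU j * D_r F j = vf (mcoef n p j) F j.
Proof.
  intros HD HF Hj; rewrite D_t_vf, D_r_vf; symmetry; now apply (vf_lin D m).
Qed.

Definition inv_mass (n : nat) (j : jet) : R := / xr j ^ (n - 1) / vrho j.

Lemma nice_pow (D : jet -> Prop) (m k : nat) (F : jet -> R) :
  jopen D -> nice D m F -> nice D m (fun j => F j ^ k).
Proof.
  intros HD HF; induction k as [|k IH]; simpl; [apply nice_const|].
  now apply nice_mult.
Qed.

Lemma vf_pow (D : jet -> Prop) (m k : nat) (X : coord -> R) (F : jet -> R) (j : jet) :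
  jopen D -> nice D m F -> D j ->
  vf X (fun i => F i ^ S k) j = INR (S k) * F j ^ k * vf X F j.
Proof.
  intros HD HF Hj; induction k as [|k IH].
  - rewrite (vf_ext D X _ F); auto; [simpl; ring|]; intros; simpl; ring.
  - change (fun i => F i ^ S (S k)) with (fun i => F i * F i ^ S k).
    rewrite (vf_mult D m), IH; auto using nice_pow.
    rewrite (S_INR (S k)); simpl (F j ^ S k); ring.
Qed.

Lemma nice_inv_mass (n : nat) (p : R -> R -> R) (D : jet -> Prop) (m : nat) :
  admissible n p D -> nice D m (inv_mass n).
Proof.
  intros (HD & H0 & _); unfold inv_mass, Rdiv; apply nice_mult; auto; apply nice_inv; auto.
  - intros j Hj; apply pow_nonzero; apply H0 in Hj; lra.
  - apply nice_pow; auto; apply nice_coord; simpl; lia.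
  - intros j Hj; apply H0 in Hj; lra.
  - apply nice_coord; simpl; lia.
Qed.

(** Conservation of mass: [1 / (r^(n-1) rho)] is stretched like a length
    element [dr] advected by the flow. *)
Lemma material_inv_mass (n : nat) (p : R -> R -> R) (D : jet -> Prop) (j : jet) :
  (1 < n)%nat -> admissible n p D -> D j ->
  vf (mcoef n p j) (inv_mass n) j = inv_mass n j * vU_r j.
Proof.
  intros hn (HD & H0 & _) Hj; unfold inv_mass, Rdiv.
  (* For [n = S (S k)] the exponent [n - 1] becomes the successor [S k], the form in which [vf_pow]
     differentiates powers. *)
  destruct n as [|[|k]]; try lia.
  replace (S (S k) - 1)%nat with (S k) by lia.
  assert (Hr : nice D 0 xr) by (apply nice_coord; simpl; lia).
  assert (Hrho : nice D 0 vrho) by (apply nice_coord; simpl; lia).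
  assert (Hr0 : forall i, D i -> xr i <> 0) by (intros i Hi; apply H0 in Hi; lra).
  assert (Hrho0 : forall i, D i -> vrho i <> 0) by (intros i Hi; apply H0 in Hi; lra).
  assert (Hp0 : forall i, D i -> xr i ^ S k <> 0) by (intros; apply pow_nonzero; auto).
  rewrite (vf_mult D 0), (vf_inv D 0 _ vrho), (vf_inv D 0 _ (fun i => xr i ^ S k)), (vf_pow D 0);
    auto using nice_pow, nice_inv.
  change (vf (mcoef (S (S k)) p j) xr j) with (vf (mcoef (S (S k)) p j) (fun i => i Rad) j).
  change (vf (mcoef (S (S k)) p j) vrho j)
    with (vf (mcoef (S (S k)) p j) (fun i => i (Var Dens 0)) j).
  rewrite !vf_coord; unfold mcoef, tcoef, rcoef, Nat.iter, nat_rect, euler_rhs.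
  change (j (Var Dens 1)) with (vrho_r j).
  specialize (Hr0 j Hj); specialize (Hrho0 j Hj).
  rewrite !S_INR; simpl (xr j ^ S k); field; repeat split; auto; apply pow_nonzero; auto.
Qed.

Lemma nice_Rop (n : nat) (p : R -> R -> R) (D : jet -> Prop) (m : nat) (F : jet -> R) :
  admissible n p D -> nice D m F -> nice D (S m) (Rop n F).
Proof.
  intros HA HF; pose proof HA as (HD & _).
  apply (nice_mult D (S m) (inv_mass n) (D_r F)); auto using nice_D_r.
  now apply (nice_inv_mass n p).
Qed.

Lemma material_Rop (n : nat) (p : R -> R -> R) (D : jet -> Prop) (m : nat) (F : jet -> R) :
  (1 < n)%nat -> admissible n p D -> nice D m F ->
  (forall j, D j -> vf (mcoef n p j) F j = 0) ->
  forall j, D j -> vf (mcoef n p j) (Rop n F) j = 0.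
Proof.
  intros hn HA HF Hinv j Hj; pose proof HA as (HD & _).
  assert (HrF : nice D (S m) (D_r F)) by auto using nice_D_r.
  change (Rop n F) with (fun i => inv_mass n i * D_r F i).
  rewrite (vf_mult D (S m)); auto; [|now apply (nice_inv_mass n p)].
  rewrite (material_inv_mass n p D j hn HA Hj).
  rewrite <- (material_vf n p D (S m)) by auto.
  rewrite (D_t_D_r_comm n p D m) by auto.
  assert (HU : nice D (S m) vU) by (apply nice_coord; simpl; lia).
  assert (HtF : nice D (S m) (D_t_on_E n p F)).
  { apply (nice_ext D _ (fun i => vf (tcoef n p i) F i)); auto.
    - intros i _; symmetry; apply D_t_vf.
    - apply (nice_vf D m); auto; intros c Hc; now apply nice_tcoef. }
  (* The invariance of [F] holds on an open set and may be differentiated. Since [D_r] also hits the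
     factor [U], the material derivative of [D_r F] is [- U_r D_r F], which cancels the stretching
     of [inv_mass]. *)
  assert (E : D_r (fun i => D_t_on_E n p F i + vU i * D_r F i) j = 0).
  { rewrite D_r_vf, (vf_ext D _ _ (fun _ => 0)); auto; [apply vf_const|].
    intros i Hi; rewrite (material_vf n p D m); auto. }
  rewrite D_r_vf, (vf_plus D (S m)), (vf_mult D (S m)) in E; auto using nice_mult.
  change (vf (rcoef j) vU j) with (vf (rcoef j) (fun i => i (Var Vel 0)) j) in E.
  rewrite vf_coord, <- !D_r_vf in E; simpl in E.
  replace (D_r (D_t_on_E n p F) j) with (- (vU_r j * D_r F j + vU j * D_r (D_r F) j)).
  - ring.
  - change (vU_r j) with (j (Var Vel 1)); lra.
Qed.

(** The coordinate [Var f (S m)] enters [D_r F] only linearly, as the coefficient of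
    [partial (Var f m) F]. *)
Lemma partial_top_D_r (D : jet -> Prop) (m : nat) (F : jet -> R) (f : fluid) (j : jet) :
  jopen D -> nice D m F -> D j ->
  partial (Var f (S m)) (D_r F) j = partial (Var f m) F j.
Proof.
  intros HD HF Hj.
  set (e := Var f (S m)).
  rewrite <- (vf_unit D (S m)) by auto using nice_D_r.
  rewrite (vf_ext D _ (D_r F) (fun i => vf (rcoef i) F i)); auto using D_r_vf.
  rewrite (vf_vf D m (S m)); auto using nice_rcoef.
  (* The terms with second derivatives run over directions [d] of order at most [m], where the unit
     field in the direction [e] has coefficient zero. *)
  rewrite (csum_zero m (fun c => csum m _)).
  - rewrite (csum_single m (Var f m)); [|simpl; lia|].
    + simpl; rewrite vf_coord; destruct (coord_eq_dec _ _); [ring | subst e; congruence].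
    + intros [| |g k] Hc; simpl; try (rewrite vf_const; ring).
      rewrite vf_coord; destruct (coord_eq_dec _ _); [subst e; congruence | ring].
  - intros c Hc; apply csum_zero; intros d Hd.
    destruct (coord_eq_dec d e); [subst d e; simpl in Hd; lia | ring].
Qed.

Lemma partial_top_Rop (n : nat) (p : R -> R -> R) (D : jet -> Prop) (m : nat)
    (F : jet -> R) (f : fluid) (j : jet) :
  admissible n p D -> nice D m F -> D j ->
  partial (Var f (S m)) (Rop n F) j = inv_mass n j * partial (Var f m) F j.
Proof.
  intros HA HF Hj; pose proof HA as (HD & _).
  change (Rop n F) with (fun i => inv_mass n i * D_r F i).
  assert (H0 := nice_inv_mass n p D 0 HA).
  rewrite partial_mult.
  - rewrite (partial_top_D_r D); auto.
    rewrite (partial_order_gt D 0 (inv_mass n)); auto; [ring | apply H0 | simpl; lia].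
  - now apply (nice_ex_derive D 0).
  - apply (nice_ex_derive D (S m)); auto using nice_D_r.
Qed.

(** Dependence on the top coordinate is obtained by contradiction: if no change of it within [D]
    altered [F], then [F] would be locally constant in that coordinate and its derivative would
    vanish. *)
Lemma scalar_invariant_intro (n : nat) (p : R -> R -> R) (D : jet -> Prop) (m : nat)
    (F : jet -> R) (f : fluid) (j : jet) :
  jopen D -> nice D m F -> (forall i, D i -> vf (mcoef n p i) F i = 0) ->
  D j -> partial (Var f m) F j <> 0 -> scalar_invariant n p D F m.
Proof.
  intros HD HF Hinv Hj Hp; split; [apply HF|]; split; [split; [apply HF|]|].
  - apply NNPP; intros H; apply Hp; unfold partial.
    rewrite <- (Derive_const (F j) (j (Var f m))); apply Derive_ext_loc.
    generalize (jopen_upd D j (Var f m) HD Hj); apply filter_imp; intros x Hx.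
    apply NNPP; intros H'; apply H; now exists f, j, x.
  - intros i Hi; rewrite (material_vf n p D m); auto.
Qed.

(** The same jet [j] and fluid variable [f] witness the order at every level: each application of
    [Rop] multiplies the top derivative by [inv_mass], which is nonzero. *)
Lemma invariant_hierarchy (n : nat) (p : R -> R -> R) (D : jet -> Prop) (m : nat)
    (F : jet -> R) (f : fluid) (j : jet) :
  (1 < n)%nat -> admissible n p D -> nice D m F ->
  (forall i, D i -> vf (mcoef n p i) F i = 0) ->
  D j -> partial (Var f m) F j <> 0 ->
  forall l, scalar_invariant n p D (Nat.iter l (Rop n) F) (l + m).
Proof.
  intros hn HA HF Hinv Hj Hp l; pose proof HA as (HD & H0 & _).
  assert (K : nice D (l + m) (Nat.iter l (Rop n) F) /\
    (forall i, D i -> vf (mcoef n p i) (Nat.iter l (Rop n) F) i = 0) /\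
    partial (Var f (l + m)) (Nat.iter l (Rop n) F) j <> 0).
  { induction l as [|l (I1 & I2 & I3)]; [auto|].
    change (Nat.iter (S l) (Rop n) F) with (Rop n (Nat.iter l (Rop n) F)).
    change (S l + m)%nat with (S (l + m)); split; [|split].
    - now apply (nice_Rop n p).
    - now apply (material_Rop n p D (l + m)).
    - rewrite (partial_top_Rop n p D); auto.
      apply Rmult_integral_contrapositive_currified; auto.
      destruct (H0 j Hj); unfold inv_mass, Rdiv.
      apply Rmult_integral_contrapositive_currified; apply Rinv_neq_0_compat; try lra.
      apply pow_nonzero; lra. }
  destruct K as (K1 & K2 & K3); now apply (scalar_invariant_intro n p D _ _ f j).
Qed.

(** * The integral [A] *)

(** The [i]-th derivative of [w^(-1/2)]. *)
Fixpoint isqrt (i : nat) (w : R) : R :=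
  match i with
  | O => / sqrt w
  | S i' => - (INR i' + / 2) * isqrt i' w / w
  end.

Lemma is_derive_isqrt (i : nat) (w : R) : 0 < w -> is_derive (isqrt i) w (isqrt (S i) w).
Proof.
  intros Hw; induction i as [|i IH].
  - assert (H := sqrt_lt_R0 w Hw); assert (E := sqrt_sqrt w (Rlt_le _ _ Hw)).
    simpl; auto_derive; [repeat split; lra|].
    rewrite E; field; lra.
  - change (isqrt (S i)) with (fun w => - (INR i + / 2) * isqrt i w / w).
    evar_last.
    + apply is_derive_div; [|apply is_derive_id|lra].
      apply is_derive_scal, IH.
    + change (isqrt (S (S i)) w)
        with (- (INR (S i) + / 2) * (- (INR i + / 2) * isqrt i w / w) / w).
      change (isqrt (S i) w) with (- (INR i + / 2) * isqrt i w / w).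
      rewrite S_INR; unfold one, minus, plus, opp, mult, scal; simpl; field; lra.
Qed.

Lemma pow_unit_le (n : nat) (y : R) : 0 <= y <= 1 -> 0 <= y ^ n <= 1.
Proof.
  intros Hy; split; [now apply pow_le|].
  rewrite <- (pow1 n); now apply pow_incr.
Qed.

(** The radicand is the convex combination of [1] and [1 + z], both positive, with weights [y ^ n]
    and [1 - y ^ n]. *)
Lemma radicand_pos (n : nat) (y z : R) :
  -1 < z -> 0 <= y <= 1 -> 0 < 1 + (1 - y ^ n) * z.
Proof. intros Hz Hy; pose proof (pow_unit_le n y Hy).
  destruct (Rle_lt_dec 0 z); nra. Qed.

Definition travel_integrand (n i : nat) (z y : R) : R :=
  (1 - y ^ n) ^ i * isqrt i (1 + (1 - y ^ n) * z).

(** [travel n 0 z] is [A] for [r = U = 1] and [z = 2 q / n]; by scaling,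
    [A n r U q = r / |U| * travel n 0 (2 r q / (n U^2))].  [travel n i] is its
    [i]-th derivative. *)
Definition travel (n i : nat) (z : R) : R := RInt (travel_integrand n i z) 0 1.

Lemma is_derive_travel_integrand (n i : nat) (z y : R) :
  0 < 1 + (1 - y ^ n) * z ->
  is_derive (fun z => travel_integrand n i z y) z (travel_integrand n (S i) z y).
Proof.
  intros Hw; unfold travel_integrand.
  replace ((1 - y ^ n) ^ S i * isqrt (S i) (1 + (1 - y ^ n) * z))
    with ((1 - y ^ n) ^ i * ((1 - y ^ n) * isqrt (S i) (1 + (1 - y ^ n) * z)))
    by (simpl ((1 - y ^ n) ^ S i); ring).
  apply (is_derive_scal (fun z => isqrt i (1 + (1 - y ^ n) * z))).
  apply (is_derive_comp (isqrt i) (fun z => 1 + (1 - y ^ n) * z)).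
  - now apply is_derive_isqrt.
  - auto_derive; auto; ring.
Qed.

Lemma continuity_2d_radicand (n : nat) (z y : R) :
  continuity_2d_pt (fun u v => 1 + (1 - v ^ n) * u) z y.
Proof.
  apply continuity_2d_pt_plus; [apply continuity_2d_pt_const|].
  apply continuity_2d_pt_mult; [|apply continuity_2d_pt_id1].
  apply continuity_2d_pt_minus; [apply continuity_2d_pt_const|].
  apply (continuity_1d_2d_pt_comp (fun v => v ^ n) (fun _ v => v)).
  - apply derivable_continuous_pt, derivable_pt_pow.
  - apply continuity_2d_pt_id2.
Qed.

Lemma continuity_2d_travel_integrand (n i : nat) (z y : R) :
  0 < 1 + (1 - y ^ n) * z -> continuity_2d_pt (travel_integrand n i) z y.
Proof.
  intros Hw; unfold travel_integrand; apply continuity_2d_pt_mult.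
  - apply (continuity_1d_2d_pt_comp (fun v => (1 - v ^ n) ^ i) (fun _ v => v)).
    + apply continuity_pt_filterlim, (ex_derive_continuous (V := R_NormedModule)).
      auto_derive; auto.
    + apply continuity_2d_pt_id2.
  - apply (continuity_1d_2d_pt_comp (isqrt i) (fun u v => 1 + (1 - v ^ n) * u)).
    + apply continuity_pt_filterlim, (ex_derive_continuous (V := R_NormedModule)).
      eexists; now apply is_derive_isqrt.
    + apply continuity_2d_radicand.
Qed.

Lemma continuous_travel_integrand (n i : nat) (z y : R) :
  -1 < z -> 0 <= y <= 1 -> continuous (travel_integrand n i z) y.
Proof.
  intros Hz Hy; apply continuity_pt_filterlim; intros e He.
  destruct (continuity_2d_travel_integrand n i z y (radicand_pos n y z Hz Hy)
    (mkposreal e He)) as [d Hd].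
  exists d; split; [apply cond_pos|]; intros v [_ Hv].
  apply Hd; [rewrite Rminus_diag, Rabs_R0; apply cond_pos | exact Hv].
Qed.

Lemma ex_RInt_travel (n i : nat) (z : R) :
  -1 < z -> ex_RInt (travel_integrand n i z) 0 1.
Proof.
  intros Hz; apply (ex_RInt_continuous (V := R_CompleteNormedModule)).
  rewrite Rmin_left, Rmax_right by lra.
  intros y Hy; now apply continuous_travel_integrand.
Qed.

Lemma is_derive_travel (n i : nat) (z : R) :
  -1 < z -> is_derive (travel n i) z (travel n (S i) z).
Proof.
  intros Hz.
  assert (L : locally z (fun x => -1 < x)) by now apply (open_gt (-1) z).
  unfold travel at 2.
  rewrite (RInt_ext _ (fun t => Derive (fun u => travel_integrand n i u t) z)).
  - apply is_derive_RInt_param; rewrite ?Rmin_left, ?Rmax_right by lra.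
    + generalize L; apply filter_imp; intros x Hx t Ht.
      eexists; apply is_derive_travel_integrand; now apply radicand_pos.
    + intros t Ht; assert (Hw := radicand_pos n t z Hz Ht).
      apply (continuity_2d_pt_ext_loc (travel_integrand n (S i)));
        [|now apply continuity_2d_travel_integrand].
      (* The neighbourhood contains points [v] outside the unit interval, where [radicand_pos] says
         nothing. Taking the radicand at [(z, t)] itself as the tolerance keeps it positive
         nearby. *)
      destruct (continuity_2d_radicand n z t (mkposreal _ Hw)) as [d Hd].
      exists d; intros u v Hu Hv; symmetry; apply is_derive_unique.
      apply is_derive_travel_integrand.
      specialize (Hd u v Hu Hv); simpl in Hd; apply Rabs_lt_between in Hd; lra.
    + generalize L; apply filter_imp; intros x Hx; now apply ex_RInt_travel.
  - rewrite Rmin_left, Rmax_right by lra; intros y Hy; symmetry; apply is_derive_unique.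
    apply is_derive_travel_integrand, radicand_pos; lra.
Qed.

(** The integrand on the left is the [y]-derivative of [y / sqrt (1 + (1 - y^n) z)]. *)
Lemma travel_ode (n : nat) (z : R) : (0 < n)%nat -> -1 < z ->
  (1 + INR n / 2 * z) * travel n 0 z + INR n * z * (1 + z) * travel n 1 z = 1.
Proof.
  intros hn Hz.
  assert (H : is_RInt (fun y => (1 + INR n / 2 * z) * travel_integrand n 0 z y +
      INR n * z * (1 + z) * travel_integrand n 1 z y) 0 1
      ((1 + INR n / 2 * z) * travel n 0 z + INR n * z * (1 + z) * travel n 1 z)).
  { apply (is_RInt_plus (V := R_NormedModule));
      apply (is_RInt_scal (V := R_NormedModule));
      apply (RInt_correct (V := R_CompleteNormedModule));
      now apply ex_RInt_travel. }
  rewrite <- (is_RInt_unique _ _ _ _ H).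
  set (df := fun y => isqrt 0 (1 + (1 - y ^ n) * z) +
    y * (- (INR n * y ^ pred n) * z * isqrt 1 (1 + (1 - y ^ n) * z))).
  assert (Edf : forall y, 0 <= y <= 1 -> (1 + INR n / 2 * z) * travel_integrand n 0 z y +
      INR n * z * (1 + z) * travel_integrand n 1 z y = df y).
  { intros y Hy; assert (Hw := radicand_pos n y z Hz Hy); unfold df, travel_integrand.
    change (isqrt 1 (1 + (1 - y ^ n) * z)) with
      (- (0 + / 2) * isqrt 0 (1 + (1 - y ^ n) * z) / (1 + (1 - y ^ n) * z)).
    (* With [n = S k], [y * y ^ pred n] is [y ^ n]. Writing [w] for the radicand, what is left is
       [w - (1 + z) * (1 - y ^ n) = y ^ n]. *)
    destruct n as [|k]; [lia|]; simpl (pred (S k)); simpl (y ^ S k) in *.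
    field; lra. }
  set (G := fun y => y * isqrt 0 (1 + (1 - y ^ n) * z)).
  (* The right-hand side [1] is this boundary term: the radicand equals [1] at [y = 1], and [G]
     vanishes at [0]. *)
  transitivity (minus (G 1) (G 0)).
  2: { unfold G, minus, plus, opp; simpl; rewrite pow1.
       replace (1 + (1 - 1) * z) with 1 by ring; rewrite sqrt_1, Rinv_1; ring. }
  apply is_RInt_unique, (is_RInt_derive (V := R_CompleteNormedModule) G);
    rewrite Rmin_left, Rmax_right by lra.
  - intros y Hy; rewrite (Edf y Hy); unfold df, G.
    assert (Hw := radicand_pos n y z Hz Hy).
    evar_last.
    + apply (is_derive_mult (fun y => y) (fun y => isqrt 0 (1 + (1 - y ^ n) * z)));
        [apply is_derive_id| |intros; apply Rmult_comm].
      apply (is_derive_comp (isqrt 0) (fun y => 1 + (1 - y ^ n) * z));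
        [now apply is_derive_isqrt|].
      auto_derive; [auto | reflexivity].
    + unfold plus, mult, scal, one; simpl; unfold mult; simpl; ring.
  - intros y Hy; apply (continuous_plus (U := R_UniformSpace) (V := R_NormedModule));
      apply (continuous_mult (U := R_UniformSpace) (K := R_AbsRing));
      auto using continuous_const, continuous_travel_integrand.
Qed.

(** The integrand is [-1/2] times [1 - y ^ n] times the radicand to the power [-3/2], negative for
    [0 < y < 1]. This is what makes [J21] really depend on [S_r]. *)
Lemma travel_1_neg (n : nat) (z : R) : (0 < n)%nat -> -1 < z -> travel n 1 z < 0.
Proof.
  intros hn Hz.
  assert (H : 0 < RInt (fun y => - travel_integrand n 1 z y) 0 1).
  { apply RInt_gt_0; [lra| |].
    - intros y Hy; assert (Hw := radicand_pos n y z Hz ltac:(lra)).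
      assert (Hy1 : y ^ n < 1).
      { apply pow_lt_1_compat; [lra | lia]. }
      unfold travel_integrand.
      change (isqrt 1 (1 + (1 - y ^ n) * z)) with
        (- (0 + / 2) * / sqrt (1 + (1 - y ^ n) * z) / (1 + (1 - y ^ n) * z)).
      assert (0 < / sqrt (1 + (1 - y ^ n) * z)) by now apply Rinv_0_lt_compat, sqrt_lt_R0.
      assert (0 < / (1 + (1 - y ^ n) * z)) by now apply Rinv_0_lt_compat.
      replace (- _) with ((1 - y ^ n) * (/ 2 * (/ sqrt (1 + (1 - y ^ n) * z) *
        / (1 + (1 - y ^ n) * z)))) by (unfold Rdiv; ring).
      repeat apply Rmult_lt_0_compat; lra.
    - intros y Hy; apply (continuous_opp (U := R_UniformSpace) (V := R_NormedModule)).
      now apply continuous_travel_integrand. }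
  rewrite (RInt_opp (V := R_CompleteNormedModule)) in H by now apply ex_RInt_travel.
  unfold opp in H; simpl in H; unfold travel; lra.
Qed.

(** The radicand is the convex combination of [U ^ 2] and [energy n r U q] with weights [y ^ n] and
    [1 - y ^ n], so the bound covers both signs of [q]. *)
Lemma A_radicand_pos (n : nat) (r U q y : R) :
  U <> 0 -> 0 < energy n r U q -> 0 <= y <= 1 ->
  0 < U ^ 2 + 2 / INR n * (1 - y ^ n) * (r * q).
Proof.
  unfold energy; intros HU HE Hy; pose proof (pow_unit_le n y Hy) as H.
  assert (0 < U ^ 2) by now apply pow2_gt_0.
  replace (_ + _) with (y ^ n * U ^ 2 + (1 - y ^ n) * (U ^ 2 + 2 / INR n * (r * q))) by ring.
  (* One of the two weights is at least [1/2], which makes its term strictly positive. *)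
  destruct (Rle_lt_dec (y ^ n) (/ 2)).
  - apply Rplus_le_lt_0_compat; [apply Rmult_le_pos | apply Rmult_lt_0_compat]; lra.
  - apply Rplus_lt_le_0_compat; [apply Rmult_lt_0_compat | apply Rmult_le_pos]; lra.
Qed.

Lemma A_unit_interval (n : nat) (r U q : R) : 0 < r -> U <> 0 -> 0 < energy n r U q ->
  A n r U q = RInt (fun y => r / sqrt (U ^ 2 + 2 / INR n * (1 - y ^ n) * (r * q))) 0 1.
Proof.
  intros Hr HU HE; unfold A.
  set (f := fun y => / sqrt (U ^ 2 + 2 / INR n * (1 - (y / r) ^ n) * (r * q))).
  assert (L := RInt_comp_lin (V := R_CompleteNormedModule) f r 0 0 1).
  replace (r * 0 + 0) with 0 in L by ring; replace (r * 1 + 0) with r in L by ring.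
  rewrite <- L.
  - apply RInt_ext; intros y _; unfold f, scal; simpl; unfold mult; simpl.
    now replace ((r * y + 0) / r) with y by (field; lra).
  - apply (ex_RInt_continuous (V := R_CompleteNormedModule)).
    rewrite Rmin_left, Rmax_right by lra; intros y Hy.
    assert (P : 0 < U ^ 2 + 2 / INR n * (1 - (y / r) ^ n) * (r * q)).
    { apply A_radicand_pos; auto; split.
      - apply Rle_div_r; lra.
      - apply Rle_div_l; lra. }
    apply (ex_derive_continuous (V := R_NormedModule)); unfold f; auto_derive.
    repeat split; auto; try lra; now apply Rgt_not_eq, sqrt_lt_R0.
Qed.

(** [U ^ 2] is factored out of the radicand, and its root is the absolute value of [U]; hence the
    opposite signs of [A] in the outflow and inflow invariants. *)
Lemma A_travel (n : nat) (r U q : R) : (0 < n)%nat -> 0 < r -> U <> 0 ->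
  0 < energy n r U q ->
  A n r U q = r / Rabs U * travel n 0 (2 / INR n * (r * q) * (/ U * / U)).
Proof.
  intros hn Hr HU HE; rewrite A_unit_interval by auto.
  set (z := 2 / INR n * (r * q) * (/ U * / U)).
  assert (Hz : -1 < z).
  { unfold energy in HE; unfold z.
    assert (0 < U * U) by (apply Rsqr_pos_lt in HU; exact HU).
    assert (0 < / U * / U) by (rewrite <- Rinv_mult; now apply Rinv_0_lt_compat).
    replace (-1) with (- (U ^ 2) * (/ U * / U)) by now field.
    apply Rmult_lt_compat_r; lra. }
  unfold travel; rewrite <- (RInt_scal (V := R_CompleteNormedModule)) by now apply ex_RInt_travel.
  apply RInt_ext; rewrite Rmin_left, Rmax_right by lra; intros y Hy.
  assert (Hw := radicand_pos n y z Hz ltac:(lra)).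
  change (r / sqrt (U ^ 2 + 2 / INR n * (1 - y ^ n) * (r * q)) =
    r / Rabs U * (1 * / sqrt (1 + (1 - y ^ n) * z))).
  replace (U ^ 2 + 2 / INR n * (1 - y ^ n) * (r * q)) with (U² * (1 + (1 - y ^ n) * z)).
  2: { unfold z, Rsqr; field; split; auto; apply not_0_INR; lia. }
  rewrite sqrt_mult, sqrt_Rsqr_abs by (try apply Rle_0_sqr; lra).
  field; split; [now apply Rgt_not_eq, sqrt_lt_R0 | now apply Rabs_no_R0].
Qed.

(** * The invariants [S], [J11] and [J21] *)

Lemma nice_opp (D : jet -> Prop) (m : nat) (F : jet -> R) :
  jopen D -> nice D m F -> nice D m (fun j => - F j).
Proof.
  intros HD HF; apply (nice_ext D m (fun j => -1 * F j)); auto; [intros; ring|].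
  apply nice_mult; auto using nice_const.
Qed.

Lemma nice_minus (D : jet -> Prop) (m : nat) (F G : jet -> R) :
  jopen D -> nice D m F -> nice D m G -> nice D m (fun j => F j - G j).
Proof. intros; apply nice_plus; auto using nice_opp. Qed.

Lemma nice_div (D : jet -> Prop) (m : nat) (F G : jet -> R) :
  jopen D -> (forall j, D j -> G j <> 0) -> nice D m F -> nice D m G ->
  nice D m (fun j => F j / G j).
Proof. intros; apply nice_mult; auto using nice_inv. Qed.

Lemma admissible_intro (n : nat) (p : R -> R -> R) (D : jet -> Prop) :
  jopen D -> (forall j, D j -> 0 < xr j /\ 0 < vrho j) -> smooth_on D (pressure p) ->
  admissible n p D.
Proof.
  intros HD H0 Hp; split; [exact HD|]; split; [exact H0|].
  assert (HP : nice D 1 (pressure p)).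
  { split; [exact Hp|]; intros j j' _ _ H; unfold pressure, vrho, vS.
    rewrite !H; simpl; auto; lia. }
  assert (Hrho := nice_partial D 1 _ (Var Dens 0) HD HP).
  assert (HS := nice_partial D 1 _ (Var Entr 0) HD HP).
  assert (C : forall g k, (k <= 1)%nat -> nice D 1 (fun j => j (Var g k))).
  { intros; now apply nice_coord. }
  assert (C' : nice D 1 xr) by (apply nice_coord; simpl; lia).
  assert (Hr0 : forall j, D j -> xr j <> 0) by (intros j Hj; apply H0 in Hj; lra).
  assert (Hrho0 : forall j, D j -> vrho j <> 0) by (intros j Hj; apply H0 in Hj; lra).
  intros [| |].
  (* The partial derivatives of [pressure p] are convertible to the [Derive] terms of [euler_rhs],
     because [upd] computes on concrete coordinates. *)
  - apply (nice_minus D 1 (fun j => - (vU j * vU_r j))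
      (fun j => (partial (Var Entr 0) (pressure p) j * vS_r j +
                 partial (Var Dens 0) (pressure p) j * vrho_r j) / vrho j)); auto.
    + apply nice_opp, nice_mult; auto; apply C; lia.
    + apply nice_div; auto; [|apply C; lia].
      apply nice_plus; auto; apply nice_mult; auto; apply C; lia.
  - apply (nice_minus D 1 (fun j => - (vU_r j * vrho j + vU j * vrho_r j))
      (fun j => (INR n - 1) / xr j * (vU j * vrho j))); auto.
    + apply nice_opp, nice_plus; auto; apply nice_mult; auto; apply C; lia.
    + apply nice_mult; auto; [apply nice_div; auto using nice_const|].
      apply nice_mult; auto; apply C; lia.
  - apply (nice_opp D 1 (fun j => vU j * vS_r j)); auto.
    apply nice_mult; auto; apply C; lia.
Qed.

Lemma jcont_coord (c : coord) (j : jet) : jcont (fun i => i c) j.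
Proof. intros P [e He]; exists e; intros j' Hj'; apply He, Hj'. Qed.

Lemma jopen_pos (D : jet -> Prop) (F : jet -> R) :
  jopen D -> (forall j, D j -> jcont F j) -> jopen (fun j => D j /\ 0 < F j).
Proof.
  intros HD HF j [Hj Hp]; apply filter_and; [now apply HD|].
  apply (HF j Hj), (open_gt 0 (F j) Hp).
Qed.

Lemma jopen_flow_domain (Om : R * R -> Prop) : open Om -> jopen (flow_domain Om).
Proof.
  intros HO j (H1 & H2 & H3); repeat apply filter_and.
  - apply (jcont_coord Rad j), (open_gt 0 _ H1).
  - apply (jcont_coord (Var Dens 0) j), (open_gt 0 _ H2).
  - destruct (HO _ H3) as [e He]; exists e; intros j' Hj'; apply He; split; apply Hj'.
Qed.

Lemma open_entropy_range (a b : Rbar) : open (entropy_range a b).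
Proof.
  assert (H : forall z : R * R, filterlim (fun z : R * R => snd z) (locally z) (locally (snd z)))
    by (intros [x y]; apply continuous_snd).
  apply open_and.
  - apply (open_comp (fun z : R * R => snd z) (fun s => Rbar_lt a s)); [auto|].
    apply open_Rbar_gt.
  - apply (open_comp (fun z : R * R => snd z) (fun s => Rbar_lt s b)); [auto|].
    apply open_Rbar_lt.
Qed.

Lemma entropy_invariant (n : nat) (p : R -> R -> R) (j : jet) :
  vf (mcoef n p j) vS j = 0.
Proof.
  change (vf (mcoef n p j) (fun i => i (Var Entr 0)) j = 0).
  rewrite vf_coord; unfold mcoef; simpl; unfold vS_r; ring.
Qed.

(** * Entropic equation of state *)

Section Entropic.

(** [D] is any open part of the flow domain, so that the whole flow domain (for [J11]) and its
    outflow and inflow parts (for [J21]) are all covered. *)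
Context (n : nat) (hn : (1 < n)%nat) (a b : Rbar) (kappa : R -> R)
  (hk : forall s : R, Rbar_lt a s -> Rbar_lt s b -> forall k, ex_derive_n kappa k s)
  (D : jet -> Prop) (HD : jopen D)
  (Hflow : forall j, D j -> flow_domain (entropy_range a b) j).

Local Notation q := (p_r_over_rho kappa).

Lemma is_derive_kappa (i : nat) (x : R) : Rbar_lt a x /\ Rbar_lt x b ->
  is_derive (Derive_n kappa i) x (Derive_n kappa (S i) x).
Proof. intros [H1 H2]; apply Derive_correct, (hk x H1 H2 (S i)). Qed.

Lemma entropy_in_range (j : jet) : D j -> Rbar_lt a (vS j) /\ Rbar_lt (vS j) b.
Proof. intros Hj; apply Hflow in Hj; apply Hj. Qed.

Lemma nice_kappa (m i : nat) : nice D m (fun j => Derive_n kappa i (vS j)).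
Proof.
  apply (nice_comp D (fun x => Rbar_lt a x /\ Rbar_lt x b)); auto.
  - exact is_derive_kappa.
  - exact entropy_in_range.
  - apply nice_coord; simpl; lia.
Qed.

Lemma flow_rad_neq0 (j : jet) : D j -> xr j <> 0.
Proof. intros Hj; apply Hflow in Hj; destruct Hj; lra. Qed.

Lemma flow_dens_neq0 (j : jet) : D j -> vrho j <> 0.
Proof. intros Hj; apply Hflow in Hj; destruct Hj as (_ & H & _); lra. Qed.

Lemma admissible_entropic : admissible n (entropic kappa) D.
Proof.
  apply admissible_intro; auto.
  - intros j Hj; apply Hflow in Hj; destruct Hj; tauto.
  - apply (nice_kappa 0 0).
Qed.

Lemma nice_xr (m : nat) : nice D m xr.
Proof. apply nice_coord; simpl; lia. Qed.

Lemma nice_vU (m : nat) : nice D m vU.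
Proof. apply nice_coord; simpl; lia. Qed.

Lemma nice_p_r_over_rho : nice D 1 q.
Proof.
  apply (nice_div D 1 (fun j => Derive_n kappa 1 (vS j) * vS_r j) vrho);
    auto using flow_dens_neq0.
  - apply nice_mult; auto using nice_kappa; apply nice_coord; simpl; lia.
  - apply nice_coord; simpl; lia.
Qed.

Lemma vf_p_r_over_rho (X : coord -> R) (j : jet) : D j ->
  vf X q j = (Derive_n kappa 2 (vS j) * X (Var Entr 0) * vS_r j +
    Derive kappa (vS j) * X (Var Entr 1)) / vrho j - q j * X (Var Dens 0) / vrho j.
Proof.
  intros Hj.
  assert (HS1 : nice D 1 vS_r) by (apply nice_coord; simpl; lia).
  assert (HS : nice D 1 vS) by (apply nice_coord; simpl; lia).
  assert (Hrho : nice D 1 vrho) by (apply nice_coord; simpl; lia).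
  assert (H0 := flow_dens_neq0).
  change (vf X (fun i => (Derive_n kappa 1 (vS i) * vS_r i) * / vrho i) j =
    (Derive_n kappa 2 (vS j) * X (Var Entr 0) * vS_r j +
    Derive kappa (vS j) * X (Var Entr 1)) / vrho j - q j * X (Var Dens 0) / vrho j).
  rewrite (vf_mult D 1), (vf_mult D 1), (vf_inv D 1 _ vrho);
    auto using nice_inv, nice_mult, nice_kappa.
  rewrite (vf_comp D (fun x => Rbar_lt a x /\ Rbar_lt x b) (Derive_n kappa) 1);
    auto using is_derive_kappa, entropy_in_range.
  change (vf X vS j) with (vf X (fun i => i (Var Entr 0)) j).
  change (vf X vS_r j) with (vf X (fun i => i (Var Entr 1)) j).
  change (vf X vrho j) with (vf X (fun i => i (Var Dens 0)) j).
  rewrite !vf_coord; unfold p_r_over_rho.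
  change (Derive_n kappa 1 (vS j)) with (Derive kappa (vS j)).
  specialize (H0 j Hj); field; auto.
Qed.

Lemma mcoef_Vel (j : jet) : mcoef n (entropic kappa) j (Var Vel 0) = - q j.
Proof.
  unfold mcoef; simpl; unfold entropic; rewrite Derive_const.
  unfold vU_r, p_r_over_rho; change (fun x => kappa x) with kappa.
  unfold Rdiv; ring.
Qed.

(** [S] is transported, so the [kappa''] term drops out. [S_r] changes at the relative rate [- U_r]
    and [1 / rho] at the rate [U_r + (n - 1) U / r]; the two [U_r] cancel. *)
Lemma material_p_r_over_rho (j : jet) : D j ->
  vf (mcoef n (entropic kappa) j) q j = (INR n - 1) * vU j / xr j * q j.
Proof.
  intros Hj; rewrite vf_p_r_over_rho by auto.
  assert (E0 : mcoef n (entropic kappa) j (Var Entr 0) = 0).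
  { unfold mcoef; simpl; unfold vS_r; ring. }
  assert (E1 : mcoef n (entropic kappa) j (Var Entr 1) = - vU_r j * vS_r j).
  { unfold mcoef; simpl; rewrite D_r_vf.
    change (vf (rcoef j) (fun i => - (vU i * vS_r i)) j + vU j * j (Var Entr 2) =
      - vU_r j * vS_r j).
    assert (HS1 : nice D 1 vS_r) by (apply nice_coord; simpl; lia).
    rewrite (vf_ext D _ _ (fun i => -1 * (vU i * vS_r i))) by (auto; intros; ring).
    rewrite (vf_mult D 1), vf_const, (vf_mult D 1);
      auto using nice_const, nice_mult, nice_vU.
    change (vf (rcoef j) vU j) with (vf (rcoef j) (fun i => i (Var Vel 0)) j).
    change (vf (rcoef j) vS_r j) with (vf (rcoef j) (fun i => i (Var Entr 1)) j).
    rewrite !vf_coord; simpl; unfold vU_r; ring. }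
  assert (E2 : mcoef n (entropic kappa) j (Var Dens 0) =
    - vU_r j * vrho j - (INR n - 1) / xr j * (vU j * vrho j)).
  { unfold mcoef; simpl; unfold vrho_r; ring. }
  rewrite E0, E1, E2; unfold p_r_over_rho.
  assert (H1 := flow_dens_neq0 j Hj); assert (H2 := flow_rad_neq0 j Hj); field; auto.
Qed.

Lemma nice_rq : nice D 1 (fun j => 2 / INR n * (xr j * q j)).
Proof.
  apply nice_mult; auto using nice_const.
  apply nice_mult; auto using nice_xr, nice_p_r_over_rho.
Qed.

Lemma vf_rq (X : coord -> R) (j : jet) : D j ->
  vf X (fun j => 2 / INR n * (xr j * q j)) j =
  2 / INR n * (X Rad * q j + xr j * vf X q j).
Proof.
  intros Hj; rewrite (vf_mult D 1), vf_const, (vf_mult D 1);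
    auto using nice_const, nice_mult, nice_xr, nice_p_r_over_rho.
  change (vf X xr j) with (vf X (fun i => i Rad) j); rewrite vf_coord; ring.
Qed.

Lemma nice_J11 : nice D 1 (J11 n kappa).
Proof.
  apply (nice_plus D 1 (fun j => vU j ^ 2)); auto using nice_rq.
  apply nice_pow; auto using nice_vU.
Qed.

Lemma vf_J11 (X : coord -> R) (j : jet) : D j ->
  vf X (J11 n kappa) j =
  2 * vU j * X (Var Vel 0) + 2 / INR n * (X Rad * q j + xr j * vf X q j).
Proof.
  intros Hj.
  change (J11 n kappa) with (fun j => vU j ^ 2 + 2 / INR n * (xr j * q j)).
  rewrite (vf_plus D 1), vf_rq, (vf_pow D 1); auto using nice_rq, nice_pow, nice_vU.
  change (vf X vU j) with (vf X (fun i => i (Var Vel 0)) j); rewrite vf_coord.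
  simpl; ring.
Qed.

Lemma INR_n_neq0 : INR n <> 0.
Proof. apply not_0_INR; lia. Qed.

(** The rate of [U ^ 2] is [- 2 U q], and that of [r q] is [U q + (n - 1) U q = n U q]; the factor
    [2 / n] is what balances them. *)
Lemma material_J11 (j : jet) : D j ->
  vf (mcoef n (entropic kappa) j) (J11 n kappa) j = 0.
Proof.
  intros Hj; rewrite vf_J11, mcoef_Vel, material_p_r_over_rho by auto.
  change (mcoef n (entropic kappa) j Rad) with (0 + vU j * 1).
  field; split; auto using INR_n_neq0, flow_rad_neq0.
Qed.

Lemma vf_unit_p_r_over_rho (j : jet) : D j ->
  vf (fun c => if coord_eq_dec c (Var Entr 1) then 1 else 0) q j =
  Derive kappa (vS j) / vrho j.
Proof.
  intros Hj; rewrite vf_p_r_over_rho by auto; simpl.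
  field; now apply flow_dens_neq0.
Qed.

Lemma partial_J11 (j : jet) : D j ->
  partial (Var Entr 1) (J11 n kappa) j =
  2 / INR n * (xr j * (Derive kappa (vS j) / vrho j)).
Proof.
  intros Hj; rewrite <- (vf_unit D 1) by auto using nice_J11.
  rewrite vf_J11, vf_unit_p_r_over_rho by auto; simpl; ring.
Qed.

Context (HU : forall j, D j -> vU j <> 0) (HJ : forall j, D j -> 0 < J11 n kappa j).

(** [J11 = U^2 (1 + pressure_ratio)]. *)
Definition pressure_ratio (j : jet) : R :=
  2 / INR n * (xr j * q j) * (/ vU j * / vU j).

Lemma pressure_ratio_gt (j : jet) : D j -> -1 < pressure_ratio j.
Proof.
  intros Hj; pose proof (HU j Hj) as H; pose proof (HJ j Hj) as E.
  change (0 < vU j ^ 2 + 2 / INR n * (xr j * q j)) in E.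
  unfold pressure_ratio; set (e := 2 / INR n * (xr j * q j)) in *.
  assert (0 < vU j * vU j) by (apply Rsqr_pos_lt in H; exact H).
  assert (0 < / vU j * / vU j) by (rewrite <- Rinv_mult; now apply Rinv_0_lt_compat).
  replace (-1) with (- (vU j ^ 2) * (/ vU j * / vU j)) by now field.
  apply Rmult_lt_compat_r; lra.
Qed.

Lemma nice_pressure_ratio : nice D 1 pressure_ratio.
Proof.
  apply (nice_mult D 1 (fun j => 2 / INR n * (xr j * q j)) (fun j => / vU j * / vU j));
    auto using nice_rq.
  apply nice_mult; auto using nice_inv, nice_vU.
Qed.

Lemma vf_pressure_ratio (X : coord -> R) (j : jet) : D j ->
  vf X pressure_ratio j =
  2 / INR n * (X Rad * q j + xr j * vf X q j) * (/ vU j * / vU j) -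
  2 * pressure_ratio j * X (Var Vel 0) * / vU j.
Proof.
  intros Hj.
  change (vf X pressure_ratio j) with
    (vf X (fun j => (2 / INR n * (xr j * q j)) * (/ vU j * / vU j)) j).
  assert (Hi : nice D 1 (fun j => / vU j)) by auto using nice_inv, nice_vU.
  rewrite (vf_mult D 1), vf_rq, (vf_mult D 1), (vf_inv D 1 _ vU);
    auto using nice_rq, nice_mult, nice_vU.
  change (vf X vU j) with (vf X (fun i => i (Var Vel 0)) j); rewrite vf_coord.
  unfold pressure_ratio; field; split; auto using INR_n_neq0.
Qed.

(** The signed [/ vU] in place of the inverse absolute value gives one expression for both
    directions of flow: it is [A - t] for [U > 0] and [- A - t] for [U < 0]. *)
Definition travel_time (j : jet) : R :=
  xr j * / vU j * travel n 0 (pressure_ratio j) + -1 * xt j.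

Lemma nice_travel (i : nat) : nice D 1 (fun j => travel n i (pressure_ratio j)).
Proof.
  apply (nice_comp D (fun z => -1 < z)); auto using pressure_ratio_gt, nice_pressure_ratio.
  intros; now apply is_derive_travel.
Qed.

Lemma nice_travel_time : nice D 1 travel_time.
Proof.
  apply (nice_plus D 1 (fun j => xr j * / vU j * travel n 0 (pressure_ratio j))
    (fun j => -1 * xt j)); auto; repeat apply nice_mult;
    auto using nice_xr, nice_inv, nice_vU, nice_travel, nice_const.
  apply nice_coord; simpl; lia.
Qed.

Lemma vf_travel_time (X : coord -> R) (j : jet) : D j ->
  vf X travel_time j =
  (X Rad * / vU j - xr j * X (Var Vel 0) * (/ vU j * / vU j)) * travel n 0 (pressure_ratio j)
  + xr j * / vU j * (travel n 1 (pressure_ratio j) * vf X pressure_ratio j) - X Time.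
Proof.
  intros Hj.
  change (vf X travel_time j) with
    (vf X (fun j => (xr j * / vU j) * travel n 0 (pressure_ratio j) + -1 * xt j) j).
  assert (Hi : nice D 1 (fun j => / vU j)) by auto using nice_inv, nice_vU.
  assert (Ht : nice D 1 xt) by (apply nice_coord; simpl; lia).
  assert (Hri : nice D 1 (fun j => xr j * / vU j)) by auto using nice_mult, nice_xr.
  assert (Htr := nice_travel 0).
  rewrite (vf_plus D 1), (vf_mult D 1 X (fun j => xr j * / vU j)), (vf_mult D 1 X xr),
    (vf_mult D 1 X (fun _ => -1)), (vf_inv D 1 _ vU), vf_const;
    auto using nice_mult, nice_const, nice_xr, nice_vU.
  rewrite (vf_comp D (fun z => -1 < z) (travel n) 1);
    auto using pressure_ratio_gt, nice_pressure_ratio, is_derive_travel.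
  change (vf X vU j) with (vf X (fun i => i (Var Vel 0)) j).
  change (vf X xr j) with (vf X (fun i => i Rad) j).
  change (vf X xt j) with (vf X (fun i => i Time) j).
  rewrite !vf_coord; ring.
Qed.

Lemma material_travel_time (j : jet) : D j ->
  vf (mcoef n (entropic kappa) j) travel_time j = 0.
Proof.
  intros Hj; rewrite vf_travel_time, vf_pressure_ratio, mcoef_Vel, material_p_r_over_rho by auto.
  change (mcoef n (entropic kappa) j Rad) with (0 + vU j * 1).
  change (mcoef n (entropic kappa) j Time) with (1 + vU j * 0).
  assert (H0 := HU j Hj); assert (Hn := INR_n_neq0); assert (Hr := flow_rad_neq0 j Hj).
  assert (O := travel_ode n _ ltac:(lia) (pressure_ratio_gt j Hj)).
  set (z := pressure_ratio j) in *.
  (* Eliminating [q] in favour of [z] turns the material derivative into the difference of the two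
     sides of [travel_ode]. *)
  assert (Eq : q j = INR n / 2 * z * (vU j * vU j) / xr j).
  { unfold z, pressure_ratio; field; auto. }
  rewrite Eq; apply Rminus_diag_eq in O; etransitivity; [|exact O]; field; auto.
Qed.

(** [S_r] enters only through [q] in [pressure_ratio], so the derivative is a nonzero multiple of
    [kappa'] times [travel n 1], which is negative. *)
Lemma partial_travel_time (j : jet) : D j -> Derive kappa (vS j) <> 0 ->
  partial (Var Entr 1) travel_time j <> 0.
Proof.
  intros Hj Hk; rewrite <- (vf_unit D 1) by auto using nice_travel_time.
  rewrite vf_travel_time, vf_pressure_ratio, vf_unit_p_r_over_rho by auto; simpl.
  assert (H0 := HU j Hj); assert (Hn := INR_n_neq0); assert (Hr := flow_rad_neq0 j Hj).
  assert (Hrho := flow_dens_neq0 j Hj).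
  assert (Ht := travel_1_neg n _ ltac:(lia) (pressure_ratio_gt j Hj)).
  replace (_ - 0) with (xr j * xr j * Derive kappa (vS j) * travel n 1 (pressure_ratio j) *
    (2 * / INR n * / vrho j * (/ vU j * / vU j * / vU j))) by (field; auto).
  repeat apply Rmult_integral_contrapositive_currified; auto using Rinv_neq_0_compat; lra.
Qed.

End Entropic.

(** * Witness jets and conclusion *)

Lemma derive_neq0_of_nonconst (a b : Rbar) (f : R -> R) (x y : R) :
  (forall s : R, Rbar_lt a s -> Rbar_lt s b -> ex_derive f s) ->
  Rbar_lt a x /\ Rbar_lt x b -> Rbar_lt a y /\ Rbar_lt y b -> f x <> f y ->
  exists s : R, (Rbar_lt a s /\ Rbar_lt s b) /\ Derive f s <> 0.
Proof.
  intros Hf [Hx1 Hx2] [Hy1 Hy2] Hxy.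
  assert (Hin : forall s, Rmin x y <= s <= Rmax x y -> Rbar_lt a s /\ Rbar_lt s b).
  { intros s [H1 H2]; split.
    - apply Rbar_lt_le_trans with (Rmin x y); [|exact H1].
      unfold Rmin; destruct (Rle_dec x y); auto.
    - apply Rbar_le_lt_trans with (Rmax x y); [exact H2|].
      unfold Rmax; destruct (Rle_dec x y); auto. }
  destruct (MVT_gen f x y (Derive f)) as (c & Hc & E).
  - intros s Hs; apply Derive_correct; apply Hf; apply Hin; lra.
  - intros s Hs; apply continuity_pt_filterlim, (ex_derive_continuous (V := R_NormedModule)).
    apply Hf; now apply Hin.
  - exists c; split; [now apply Hin|]; intros H0; rewrite H0 in E; lra.
Qed.

(** A locally uniform flow. Since [S_r = 0], the pressure term vanishes and [J11 = U * U] for every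
    [kappa]; thus [U = 1] and [U = -1] give points of the outflow and inflow domains. *)
Definition rest_jet (s U : R) (c : coord) : R :=
  match c with
  | Rad => 1
  | Var Vel O => U
  | Var Dens O => 1
  | Var Entr O => s
  | _ => 0
  end.

(** Treats outflow and inflow together: [F] is the expression in [A], and smoothness, invariance and
    the nonzero derivative are carried over to it from [travel_time], with which it agrees on the
    open set [D]. *)
Lemma J2_invariant (n : nat) (a b : Rbar) (kappa : R -> R) (D : jet -> Prop)
    (F : jet -> R) (s U : R) :
  (1 < n)%nat ->
  (forall s : R, Rbar_lt a s -> Rbar_lt s b -> forall k, ex_derive_n kappa k s) ->
  jopen D -> (forall j, D j -> flow_domain (entropy_range a b) j) ->
  (forall j, D j -> vU j <> 0) -> (forall j, D j -> 0 < J11 n kappa j) ->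
  (forall j, D j -> travel_time n kappa j = F j) ->
  D (rest_jet s U) -> Derive kappa s <> 0 ->
  forall l, (1 <= l)%nat ->
  scalar_invariant n (entropic kappa) D (Nat.iter (l - 1) (Rop n) F) l.
Proof.
  intros hn hk HD Hflow HU HJ HF Hj Hs l Hl.
  assert (HN : nice D 1 (travel_time n kappa)) by now apply (nice_travel_time n hn a b).
  replace l with (l - 1 + 1)%nat at 2 by lia.
  apply (invariant_hierarchy n _ D 1 F Entr (rest_jet s U)); auto.
  - now apply (admissible_entropic n hn a b).
  - now apply (nice_ext D 1 (travel_time n kappa)).
  - intros i Hi; rewrite <- (vf_ext D _ (travel_time n kappa)) by auto.
    now apply (material_travel_time n hn a b kappa hk D).
  - rewrite <- (partial_ext D (travel_time n kappa)) by auto.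
    now apply (partial_travel_time n hn a b kappa hk D).
Qed.

Theorem theorem3p4 (n : nat) (hn : (1 < n)%nat) :
  (forall (Om : R * R -> Prop) (p : R -> R -> R),
     open Om ->
     (exists rho s : R, 0 < rho /\ Om (rho, s)) ->
     smooth_on (flow_domain Om) (pressure p) ->
     forall l : nat, scalar_invariant n p (flow_domain Om) (J n l) l)
  /\
  (forall (a b : Rbar) (kappa : R -> R),
     (forall s : R, Rbar_lt a s -> Rbar_lt s b ->
        forall k : nat, ex_derive_n kappa k s) ->
     (exists s1 s2 : R,
        (Rbar_lt a s1 /\ Rbar_lt s1 b) /\ (Rbar_lt a s2 /\ Rbar_lt s2 b) /\
        kappa s1 <> kappa s2) ->
     let Om := entropy_range a b in
     (forall l : nat, (1 <= l)%nat ->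
        scalar_invariant n (entropic kappa) (flow_domain Om) (J1 n kappa l) l) /\
     (forall l : nat, (1 <= l)%nat ->
        scalar_invariant n (entropic kappa)
          (outflow_domain n kappa Om) (J2 n kappa l) l) /\
     (forall l : nat, (1 <= l)%nat ->
        scalar_invariant n (entropic kappa)
          (inflow_domain n kappa Om) (J2_inflow n kappa l) l))
  /\
  (forall r U q : R, 0 < r -> U <> 0 -> 0 < energy n r U q ->
     A n r U q =
     RInt (fun y => r / sqrt (U ^ 2 + 2 / INR n * (1 - y ^ n) * (r * q))) 0 1).
Proof.
  split; [|split].
  - intros Om p HOm (rho & s & Hrho & Hs) Hp l.
    assert (HD := jopen_flow_domain Om HOm).
    rewrite <- (Nat.add_0_r l) at 2.
    apply (invariant_hierarchy n p _ 0 vS Entr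
      (fun c => match c with Rad => 1 | Var Dens O => rho | Var Entr O => s | _ => 0 end)); auto.
    + apply admissible_intro; auto; intros j (H1 & H2 & _); auto.
    + apply nice_coord; simpl; lia.
    + intros; now apply entropy_invariant.
    + repeat split; simpl; auto; exact Rlt_0_1.
    + change vS with (fun i : jet => i (Var Entr 0)); rewrite partial_coord; simpl; lra.
  - intros a b kappa hk (s1 & s2 & H1 & H2 & H12) Om.
    destruct (derive_neq0_of_nonconst a b kappa s1 s2) as (s & Hs & Hs0); auto.
    { intros s Ha Hb; apply (hk s Ha Hb 1%nat). }
    assert (HD : jopen (flow_domain Om)) by apply jopen_flow_domain, open_entropy_range.
    assert (Hrest : forall U, flow_domain Om (rest_jet s U)).
    { intros U; repeat split; simpl; try apply Hs; exact Rlt_0_1. }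
    assert (HJ : nice (flow_domain Om) 1 (J11 n kappa)) by now apply (nice_J11 n hn a b).
    assert (HrestJ : forall U, J11 n kappa (rest_jet s U) = U * U).
    { intros U; unfold J11, energy, p_r_over_rho, vU, vS_r; simpl; unfold Rdiv; ring. }
    assert (hn0 : (0 < n)%nat) by lia.
    split; [|split].
    (* The seed is already of order one and is the member [l = 1], so [l - 1] applications of [Rop]
       give order [l]. *)
    + intros l Hl; unfold J1; replace l with (l - 1 + 1)%nat at 2 by lia.
      apply (invariant_hierarchy n _ _ 1 _ Entr (rest_jet s 1)); auto.
      * now apply (admissible_entropic n hn a b).
      * intros i Hi; now apply (material_J11 n hn a b kappa hk (flow_domain Om)).
      * rewrite (partial_J11 n hn a b kappa hk (flow_domain Om)) by auto.
        change (2 / INR n * (1 * (Derive kappa s / 1)) <> 0).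
        unfold Rdiv; assert (Hn : INR n <> 0) by now apply (INR_n_neq0 n).
        repeat apply Rmult_integral_contrapositive_currified;
          auto using Rinv_neq_0_compat; try apply Rinv_neq_0_compat; lra.
    + apply (J2_invariant n a b kappa _ _ s 1); auto.
      * intros j (Hj1 & Hj2 & Hj3).
        assert (L := jopen_pos _ vU HD (fun j _ => jcont_coord (Var Vel 0) j)).
        assert (L' := jopen_pos _ _ HD (fun j Hj => nice_cont _ _ _ j HJ Hj)).
        generalize (filter_and _ _ (L j (conj Hj1 Hj2)) (L' j (conj Hj1 Hj3))).
        apply filter_imp; unfold outflow_domain; tauto.
      * intros j Hj; apply Hj.
      * intros j (_ & Hj & _); lra.
      * intros j Hj; apply Hj.
      * intros j (Hj1 & Hj2 & Hj3); unfold travel_time, J21.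
        rewrite A_travel; auto; [|apply Hj1 | lra].
        rewrite Rabs_pos_eq by lra; unfold pressure_ratio; field; lra.
      * repeat split; try apply Hrest; rewrite ?HrestJ; unfold vU; simpl; lra.
    + apply (J2_invariant n a b kappa _ _ s (-1)); auto.
      * intros j (Hj1 & Hj2 & Hj3).
        assert (HnU : nice (flow_domain Om) 0 (fun j => - vU j)).
        { apply nice_opp; auto; apply nice_coord; simpl; lia. }
        assert (L := jopen_pos _ _ HD (fun j Hj => nice_cont _ _ _ j HnU Hj)).
        assert (L' := jopen_pos _ _ HD (fun j Hj => nice_cont _ _ _ j HJ Hj)).
        assert (Hj2' : 0 < - vU j) by lra.
        generalize (filter_and _ _ (L j (conj Hj1 Hj2')) (L' j (conj Hj1 Hj3))).
        apply filter_imp; unfold inflow_domain; intros i [[I1 I2] [_ I3]].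
        repeat split; auto; try apply I1; lra.
      * intros j Hj; apply Hj.
      * intros j (_ & Hj & _); lra.
      * intros j Hj; apply Hj.
      * intros j (Hj1 & Hj2 & Hj3); unfold travel_time.
        rewrite A_travel; auto; [|apply Hj1 | lra].
        rewrite Rabs_left by lra; unfold pressure_ratio; field; lra.
      * repeat split; try apply Hrest; rewrite ?HrestJ; unfold vU; simpl; lra.
  - intros; now apply A_unit_interval.
Qed.
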